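(* Let $(M,g)$ be a Riemannian manifold with $\dim M=2$ and let $G$ be a natural metric on $TM$ characterized by the functions $\alpha,\beta$. Then $(TM,G)$ is flat if and only if $(M,g)$ is flat and $H=0$.
   Context: All objects are $C^\infty$; a dot denotes derivative; $n=\dim M$. $\pi:TM\to M$ is the tangent bundle, $K:TTM\to TM$ the connection map of the Levi-Civita connection $\nabla$ of $g$ (the velocity at $0$ of a curve $Y(s)$ in $TM$ is sent to its covariant derivative $\frac{\nabla Y}{ds}(0)$). For $q\in M$, $u=(u_1,\dots,u_n)$ an orthonormal basis of $M_q$, $\xi\in\mathbb{R}^n$ and $v=\sum_i\xi^iu_i$, let $e_i(q,u,\xi),e_{n+i}(q,u,\xi)\in(TM)_v$ ($1\le i\le n$) be the vectors with $\pi_*(e_i)=u_i$, $K(e_i)=0$, $\pi_*(e_{n+i})=0$, $K(e_{n+i})=u_i$. A natural metric on $TM$ is a Riemannian metric $G$ such that $\pi:(TM,G)\to(M,g)$ is a Riemannian submersion, the horizontal spaces $\ker K_v$ and vertical spaces $\ker\pi_{*v}$ are $G$-orthogonal, and the matrix of $G$ in the basis $e_1(q,u,\xi),\dots,e_{2n}(q,u,\xi)$ depends only on $\xi$. Equivalently, there are differentiable functions $\alpha,\beta:[0,+\infty)\to\mathbb{R}$ with $\alpha(t)>0$ and $\alpha(t)+t\beta(t)>0$ for all $t\ge0$ (the functions characterizing $G$) such that at $(q,u,\xi)$: $G(e_i,e_j)=\delta_{ij}$, $G(e_i,e_{n+j})=0$, $G(e_{n+i},e_{n+j})=\alpha(|\xi|^2)\delta_{ij}+\beta(|\xi|^2)\xi^i\xi^j$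 for $1\le i,j\le n$. Flat means that the curvature tensor vanishes identically. With $\phi(t)=\alpha(t)+t\dot\alpha(t)$ and $\Delta(t)=\alpha(t)+t\beta(t)$, the function $H:[0,+\infty)\to\mathbb{R}$ is $H(t)=\phi(t)\frac{d}{dt}\ln(\alpha\Delta)(t)-2\dot\phi(t)$. *)

(* Defs.v *)
From HB Require Import structures.
From mathcomp Require Import all_boot all_order all_algebra.
From mathcomp Require Import all_classical all_reals all_analysis.
Import Order.TTheory GRing.Theory Num.Theory.
Import numFieldNormedType.Exports.

Set Implicit Arguments.
Unset Strict Implicit.
Unset Printing Implicit Defensive.

Local Open Scope classical_set_scope.
Local Open Scope ring_scope.

Section Smooth.
Context {R : realType} {n : nat}.

Definition partial (i : 'I_n) (f : 'rV[R]_n -> R) : 'rV[R]_n -> R :=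
  fun x => 'D_(delta_mx 0 i : 'rV[R]_n) f x.

(* Meant for open U: every iterated partial derivative is Frechet
   differentiable at every point of U, i.e. f is C^oo on U. *)
Definition smooth_on (U : set 'rV[R]_n) (f : 'rV[R]_n -> R) : Prop :=
  forall (s : seq 'I_n) x, U x -> differentiable (foldr partial f s) x.

End Smooth.

(* The charts of a manifold modelled on R^n: chart a has domain dom a and
   coordinate map crd a, whose values off dom a are irrelevant. *)
Record atlas (R : realType) (X : Type) (n : nat) := Atlas {
  chart : Type;
  dom : chart -> set X;
  crd : chart -> X -> 'rV[R]_n }.

Section Charts.
Context {R : realType}.

(* crd b \o f \o (crd a)^-1, on the set local_dom where it makes sense. *)
Definition local_dom (X Y : Type) n m (A : atlas R X n) (B : atlas R Y m)
    (f : X -> Y) (a : chart A) (b : chart B) : set 'rV[R]_n :=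
  crd a @` (dom a `&` f @^-1` dom b).

Definition local_rep (X Y : Type) n m (A : atlas R X n) (B : atlas R Y m)
    (f : X -> Y) (a : chart A) (b : chart B) (x : 'rV[R]_n) : 'rV[R]_m :=
  xget 0 [set y | exists p,
    [/\ dom a p, dom b (f p), crd a p = x & crd b (f p) = y]].

Definition smooth_map (X Y : Type) n m (A : atlas R X n) (B : atlas R Y m)
    (f : X -> Y) : Prop :=
  forall (a : chart A) (b : chart B) (k : 'I_m),
    smooth_on (local_dom f a b) (fun x => local_rep f a b x 0 k).

Definition transition (X : Type) n (A : atlas R X n) (a b : chart A) :=
  local_rep idfun a b.

End Charts.

Record manifold (R : realType) (n : nat) := Manifold {
  space :> topologicalType;
  charts :> atlas R space n;
  space_nonempty : exists p : space, True;
  space_hausdorff : hausdorff_space space;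
  space_second_countable : @second_countable space;
  charts_cover : forall p, exists a : chart charts, dom a p;
  dom_open : forall a : chart charts, open (dom a);
  crd_inj : forall a : chart charts, {in dom a &, injective (crd a)};
  crd_continuous : forall a : chart charts,
    {within dom a, continuous (crd a)};
  crd_open : forall (a : chart charts) (V : set space),
    V `<=` dom a -> open V -> open (crd a @` V);
  charts_smooth : smooth_map charts charts idfun }.

Section TangentSpace.
Context {R : realType} {X : Type} {n : nat} (A : atlas R X n) (p : X).

(* A tangent vector at p is the family of its components in the charts at p,
   related by the differentials of the transition maps.  The components in
   the charts not containing p are set to 0, so that a tangent vector is
   determined by its components in any one chart at p. *)
Definition tangent_family (v : chart A -> 'rV[R]_n) : Prop :=
  (forall a, ~ dom a p -> v a = 0) /\
  (forall a b, dom a p -> dom b p ->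
     v b = 'd (transition a b) (crd a p) (v a)).

Definition tangent_pred : pred (chart A -> 'rV[R]_n) :=
  fun v => `[< tangent_family v >].

Fact tangent_submod_closed : submod_closed tangent_pred.
Proof.
split=> [|c u v /asboolP[u0 uE] /asboolP[v0 vE]]; apply/asboolP; split.
- by [].
- by move=> a b _ _; rewrite linear0.
- move=> a pa; rewrite -[LHS]/(c *: u a + v a).
  by rewrite u0 // v0 // scaler0 addr0.
- move=> a b pa pb; rewrite -[LHS]/(c *: u b + v b).
  by rewrite (uE a b pa pb) (vE a b pa pb) -linearP.
Qed.

HB.instance Definition _ :=
  GRing.isSubmodClosed.Build R (chart A -> 'rV[R]_n) tangent_pred
    tangent_submod_closed.

Definition tangent : Type := {v : chart A -> 'rV[R]_n | tangent_pred v}.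
HB.instance Definition _ := SubType.on tangent.
HB.instance Definition _ := [Choice of tangent by <:].
HB.instance Definition _ := [SubChoice_isSubLmodule of tangent by <:].

Definition cpt (v : tangent) (a : chart A) : 'rV[R]_n := val v a.

End TangentSpace.

(* V is the image of U under the differential of f at p. *)
Definition pushes_to (R : realType) (X Y : Type) n m (A : atlas R X n)
    (B : atlas R Y m) (f : X -> Y) (p : X) (U : tangent A p)
    (V : tangent B (f p)) : Prop :=
  forall a b, dom a p -> dom b (f p) ->
    cpt V b = 'd (local_rep f a b) (crd a p) (cpt U a).

(* gmx a is the matrix of components in chart a, a function of the
   coordinates; only its values on crd a @` dom a matter.  Bilinearity of
   inner follows from innerE. *)
Record metric (R : realType) (X : Type) n (A : atlas R X n) := Metric {
  inner : forall p : X, tangent A p -> tangent A p -> R;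
  gmx : chart A -> 'rV[R]_n -> 'M[R]_n;
  innerE : forall a p (u v : tangent A p), dom a p ->
    inner u v = (cpt u a *m gmx a (crd a p) *m (cpt v a)^T) 0 0;
  inner_sym : forall p (u v : tangent A p), inner u v = inner v u;
  inner_pos : forall p (u : tangent A p), u != 0 -> 0 < inner u u;
  gmx_smooth : forall a i j,
    smooth_on (crd a @` dom a) (fun x => gmx a x i j) }.

Section LeviCivita.
Context {R : realType} {n : nat} (g : 'rV[R]_n -> 'M[R]_n).
Implicit Types (x : 'rV[R]_n) (i j k l : 'I_n).

(* Gamma^k_ij of the Levi-Civita connection of the metric matrix g. *)
Definition christoffel i j k x : R :=
  2^-1 * \sum_l invmx (g x) k l *
    (partial i (fun y => g y j l) x + partial j (fun y => g y i l) x
     - partial l (fun y => g y i j) x).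

(* The component of Rm(d_i, d_j) d_k along d_l, where
   Rm(U, V) W = D_U D_V W - D_V D_U W - D_[U, V] W. *)
Definition curvature i j k l x : R :=
  partial i (christoffel j k l) x - partial j (christoffel i k l) x
  + \sum_m (christoffel j k m x * christoffel i m l x
            - christoffel i k m x * christoffel j m l x).

(* The covariant derivative of a field Y along a curve c, in coordinates:
   (DY/ds)^k = (Y^k)' + Gamma^k_ij (c^i)' Y^j, where c, c', Y, Y' take the
   values x, dx, y, dy. *)
Definition covariant_derivative x (dx y dy : 'rV[R]_n) : 'rV[R]_n :=
  \row_k (dy 0 k + \sum_i \sum_j christoffel i j k x * dx 0 i * y 0 j).

End LeviCivita.

Definition flat (R : realType) (X : Type) n (A : atlas R X n)
    (g : metric A) : Prop :=
  forall (a : chart A) x, (crd a @` dom a) x ->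
    forall i j k l, curvature (gmx g a) i j k l x = 0.

Section RiemannianSubmersion.
Context {R : realType} {X Y : Type} {n m : nat}.
Context (A : atlas R X n) (B : atlas R Y m).

Definition normal_to_fibre (G : metric A) (f : X -> Y) (p : X)
    (U : tangent A p) : Prop :=
  forall V : tangent A p, @pushes_to _ _ _ _ _ A B f p V 0 -> inner G U V = 0.

Definition riemannian_submersion (G : metric A) (g : metric B) (f : X -> Y) :=
  [/\ smooth_map A B f,
      forall q, exists p, f p = q,
      forall p (V : tangent B (f p)), exists U : tangent A p, pushes_to U V
    & forall p (U1 U2 : tangent A p) (V1 V2 : tangent B (f p)),
        normal_to_fibre G f U1 -> normal_to_fibre G f U2 ->
        pushes_to U1 V1 -> pushes_to U2 V2 -> inner G U1 U2 = inner g V1 V2].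

End RiemannianSubmersion.

Section TangentBundle.
Context {R : realType} {X : Type} {n : nat} (A : atlas R X n).

Definition TM : Type := {p : X & tangent A p}.
Definition proj (v : TM) : X := projT1 v.
Definition vect (v : TM) : tangent A (proj v) := projT2 v.

(* The natural charts (x, y) of TM induced by the charts x of M. *)
Definition TM_atlas : atlas R TM (n + n) :=
  @Atlas R TM (n + n) (chart A)
    (fun a v => dom a (proj v))
    (fun a v => row_mx (crd a (proj v)) (cpt (vect v) a)).

(* K(e) = w.  The components of e are (c'(0), Y'(0)) for a curve Y(s) in TM
   over c(s) with velocity e at 0. *)
Definition connection_map (g : metric A) (v : TM) (e : tangent TM_atlas v)
    (w : tangent A (proj v)) : Prop :=
  forall a, dom a (proj v) ->
    cpt w a = covariant_derivative (gmx g a) (crd a (proj v))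
      (lsubmx (cpt e a)) (cpt (vect v) a) (rsubmx (cpt e a)).

Definition proj_star (v : TM) (e : tangent TM_atlas v)
    (w : tangent A (proj v)) : Prop :=
  @pushes_to _ _ _ _ _ TM_atlas A proj v e w.

Definition orthonormal (g : metric A) (q : X) (u : 'I_n -> tangent A q) :=
  forall i j, inner g (u i) (u j) = (i == j)%:R.

Definition vector_at (q : X) (u : 'I_n -> tangent A q) (xi : 'rV[R]_n) : TM :=
  existT _ q (\sum_i xi 0 i *: u i).

(* e (lshift n i) and e (rshift n i) are e_i and e_{n+i} at (q, u, xi). *)
Definition adapted_basis (g : metric A) (q : X) (u : 'I_n -> tangent A q)
    (xi : 'rV[R]_n) (e : 'I_(n + n) -> tangent TM_atlas (vector_at u xi)) :=
  forall i : 'I_n,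
    [/\ proj_star (e (lshift n i)) (u i),
        connection_map g (e (lshift n i)) 0,
        proj_star (e (rshift n i)) 0
      & connection_map g (e (rshift n i)) (u i)].

Definition natural_metric (g : metric A) (G : metric TM_atlas) : Prop :=
  [/\ riemannian_submersion G g proj,
      forall (v : TM) (e f : tangent TM_atlas v),
        connection_map g e 0 -> proj_star f 0 -> inner G e f = 0
    & exists N : 'rV[R]_n -> 'M[R]_(n + n),
        forall q (u : 'I_n -> tangent A q) xi
               (e : 'I_(n + n) -> tangent TM_atlas (vector_at u xi)),
          orthonormal g u -> adapted_basis g e ->
          forall i j, inner G (e i) (e j) = N xi i j].

End TangentBundle.

Section HalfLine.
Context {R : realType}.
Implicit Types (f : R -> R) (t : R).

(* Functions on [0, +oo) are represented by functions on R of which only the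
   values on [0, +oo) are used; the derivative at 0 is one-sided. *)
Definition half_quotient f t : set_system R :=
  (f s - f t) / (s - t) @[s --> within [set s | 0 <= s] t^'].

Definition half_deriv f t : R := lim (half_quotient f t).

Definition half_smooth f : Prop :=
  forall k t, 0 <= t -> cvg (half_quotient (iter k half_deriv f) t).

Definition Delta_fun (alpha beta : R -> R) t : R := alpha t + t * beta t.

Definition phi_fun (alpha : R -> R) t : R := alpha t + t * half_deriv alpha t.

Definition H_fun (alpha beta : R -> R) t : R :=
  phi_fun alpha t * half_deriv (fun s => ln (alpha s * Delta_fun alpha beta s)) t
  - 2 * half_deriv (phi_fun alpha) t.

End HalfLine.

Definition sqnorm (R : realType) n (xi : 'rV[R]_n) : R := \sum_i xi 0 i ^+ 2.

(* alpha and beta are the functions characterizing G. *)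
Definition characterized (R : realType) (X : Type) n (A : atlas R X n)
    (g : metric A) (G : metric (TM_atlas A)) (alpha beta : R -> R) : Prop :=
  [/\ half_smooth alpha, half_smooth beta,
      forall t, 0 <= t -> 0 < alpha t,
      forall t, 0 <= t -> 0 < alpha t + t * beta t
    & forall q (u : 'I_n -> tangent A q) xi
             (e : 'I_(n + n) -> tangent (TM_atlas A) (vector_at u xi)),
        orthonormal g u -> adapted_basis g e ->
        forall i j : 'I_n,
          [/\ inner G (e (lshift n i)) (e (lshift n j)) = (i == j)%:R,
              inner G (e (lshift n i)) (e (rshift n j)) = 0
            & inner G (e (rshift n i)) (e (rshift n j))
              = alpha (sqnorm xi) * (i == j)%:R
                + beta (sqnorm xi) * xi 0 i * xi 0 j]].

(* Main.v *)
(* Let v.w = g(v, w), t = y.y and u, k stand for the horizontal and vertical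
   (connection map) components of a vector tangent to TM at y.  The hypothesis on
   G says that in every natural chart
     G = u.u + alpha(t) k.k + beta(t) (k.y)^2 .
   On the zero section the Christoffel symbols of G restrict to those of g, so
   flatness of G forces that of g.  Conversely, let g be flat.  Parallel transport
   of g preserves the fibre metrics, hence in the frame (u, k) the Levi-Civita
   connection of G is block diagonal: that of g on the horizontal part, and on the
   vertical part that of g plus the Christoffel tensor of the fibre metric.  Its
   curvature is therefore the curvature of the fibres, which are surfaces of
   revolution when dim M = 2; the curvature of such a fibre at y is a multiple of
   H(t).  Since every t >= 0 is some y.y, it vanishes iff H = 0. *)

Require Import Defs.
From mathcomp Require Import all_boot all_order all_algebra.
From mathcomp Require Import all_classical all_reals all_analysis.
From mathcomp Require Import ring lra.
Import Order.TTheory GRing.Theory Num.Theory.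
Import numFieldNormedType.Exports.
Set Implicit Arguments.
Unset Strict Implicit.
Unset Printing Implicit Defensive.
Local Open Scope classical_set_scope.
Local Open Scope ring_scope.

(** * Directional derivatives of functions and matrices *)

(** The connection of G is not found by inverting its matrix. A candidate is written in the frame
    (u, k), checked to be symmetric and metric, and identified by uniqueness; the curvature is then
    computed in that frame. No flat coordinates or parallel frames are built: flatness of g is used
    as an identity between derivatives and products of its Christoffel matrices, which makes second
    covariant derivatives commute.

    The link with H is algebraic. For k = v = y and l orthogonal to y, the fibre curvature R(k, l) v
    is a multiple of l, with a factor -t (F1 + t F3) such that alpha (F1 + t F3) = H. In dimension 2
    this single number controls the whole tensor: skew-symmetry of the curvature operator ties the
    remaining coefficient F2 to it, and an identity between any four vectors of the plane merges the
    three terms.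

    Two features of the data shape the rest. The values of G are given on adapted bases only, and
    the connection map is a condition in every chart, so the transformation laws of charts, metrics
    and connections must be established before the matrix of G is known. And t = y.y reaches the end
    point 0 on the zero section, where the derivatives of alpha and beta are one-sided. *)

Section FrechetDerivative.
Context {R : realType} {V : normedModType R}.
Implicit Types (z v : V) (f g : V -> R).

(** Frechet differentiability travels with the value, since derivability in one direction is not
    preserved by composition. *)
Definition fder z v f (d : R) : Prop := differentiable f z /\ 'D_v f z = d.

Lemma fderE z v f d : fder z v f d -> 'D_v f z = d.
Proof. by case. Qed.

Lemma fder_eq z v f d d' : fder z v f d -> d = d' -> fder z v f d'.
Proof. by move=> ? <-. Qed.

Lemma fder_cst z v (c : R) : fder z v (fun=> c) 0.
Proof. by split; [exact: differentiable_cst|exact: derive_cst]. Qed.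

Lemma fderD z v f g df dg : fder z v f df -> fder z v g dg ->
  fder z v (fun x => f x + g x) (df + dg).
Proof.
move=> [Df <-] [Dg <-]; split; first exact: differentiableD.
by rewrite deriveD//; exact: diff_derivable.
Qed.

Lemma fderM z v f g df dg : fder z v f df -> fder z v g dg ->
  fder z v (fun x => f x * g x) (df * g z + f z * dg).
Proof.
move=> [Df <-] [Dg <-]; split; first exact: differentiableM.
rewrite deriveM; [|exact: diff_derivable..].
by rewrite addrC mulrC.
Qed.

Lemma fderV z v f df : fder z v f df -> f z != 0 ->
  fder z v (fun x => (f x)^-1) (- df / f z ^+ 2).
Proof.
move=> [Df <-] f0; split; first exact: differentiableV.
rewrite deriveV//; last exact: diff_derivable.
rewrite -[LHS]/(- (f z) ^- 2 * 'D_v f z); ring.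
Qed.

Lemma fder_sum z v (I : Type) (r : seq I) (P : pred I) (F : I -> V -> R)
    (dF : I -> R) :
  (forall i, P i -> fder z v (F i) (dF i)) ->
  fder z v (fun x => \sum_(i <- r | P i) F i x) (\sum_(i <- r | P i) dF i).
Proof.
move=> FdF; elim: r => [|i r IH].
  by under eq_fun do rewrite big_nil; rewrite big_nil; exact: fder_cst.
under eq_fun do rewrite big_cons; rewrite big_cons.
by case: ifP => // Pi; apply: fderD => //; exact: FdF.
Qed.

Lemma near_eq_differentiable (W : normedModType R) (z : V) (f g : V -> W) :
  {near z, f =1 g} -> differentiable f z -> differentiable g z.
Proof.
move=> fg df; have fgz := nbhs_singleton fg.
have eg : g \o shift z = cst (g z) + 'd f z +o_ 0 id.
  apply/eqaddoP => e e0; have /eqaddoP/(_ e e0) := diff_locally df.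
  have : \forall h \near (0 : V), f (h + z) = g (h + z).
    have : \forall h \near z, f h = g h by [].
    by rewrite (near_shift 0 z); apply: filterS => h /=; rewrite subr0.
  apply: filterS2 => h fgh.
  change (`|f (h + z) - (f z + 'd f z h)| <= e * `|h| ->
          `|g (h + z) - (g z + 'd f z h)| <= e * `|h|).
  by rewrite fgh fgz.
have dfc := diff_continuous df.
by apply/diff_locallyP; rewrite (diff_unique dfc eg); split.
Qed.

Lemma near_eq_fder z v f g d : {near z, f =1 g} -> fder z v f d -> fder z v g d.
Proof.
move=> fg [df <-]; split; first exact: near_eq_differentiable df.
by apply: near_eq_derive; near do apply/esym.
Unshelve. all: by end_near. Qed.

Lemma fder_comp (W : normedModType R) (h : V -> W) (f : W -> R) z v :
  differentiable h z -> differentiable f (h z) ->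
  fder z v (f \o h) ('D_('D_v h z) f (h z)).
Proof.
move=> dh df; split; first exact: differentiable_comp.
rewrite [LHS]deriveE; last exact: differentiable_comp.
by rewrite diff_comp//= [RHS]deriveE// deriveE.
Qed.

Lemma fder_comp_real (f : V -> R) (F : R -> R) z v d dF :
  fder z v f d -> is_derive (f z) 1 F dF -> fder z v (F \o f) (dF * d).
Proof.
move=> [df <-] [dF1 <-].
have dF' : differentiable F (f z) by exact/derivable1_diffP.
apply: fder_eq; first exact: fder_comp.
rewrite !deriveE// -[X in 'd F _ X]mulr1.
by rewrite -[_ * 1]/(_ *: 1) linearZ/= mulrC.
Qed.

End FrechetDerivative.

Section Coordinates.
Context {R : realType}.

Lemma derive_partial n (f : 'rV[R]_n -> R) z v : differentiable f z ->
  'D_v f z = \sum_i v 0 i * partial i f z.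
Proof.
move=> df; rewrite deriveE// {1}(row_sum_delta v) linear_sum.
by apply: eq_bigr => i _; rewrite linearZ /partial deriveE.
Qed.

Lemma differentiable_row (V : normedModType R) n (h : V -> 'rV[R]_n) z :
  (forall i, differentiable (fun x => h x 0 i) z) -> differentiable h z.
Proof.
move=> dh.
have -> : h = \sum_(i < n) (fun x => h x 0 i *: delta_mx 0 i).
  by apply/funext => x; rewrite fct_sumE -row_sum_delta.
by apply: differentiable_sum => i; exact: differentiableZl.
Qed.

Lemma derive_row (V : normedModType R) n (h : V -> 'rV[R]_n) z v i :
  differentiable h z -> ('D_v h z) 0 i = 'D_v (fun x => h x 0 i) z.
Proof. by move=> dh; rewrite derive_mx ?mxE//; exact: diff_derivable. Qed.

Lemma fder_comp_row (V : normedModType R) n (h : V -> 'rV[R]_n) (f : 'rV[R]_n -> R)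
    z v (dh : 'I_n -> R) :
  (forall i, fder z v (fun x => h x 0 i) (dh i)) -> differentiable f (h z) ->
  fder z v (f \o h) (\sum_i dh i * partial i f (h z)).
Proof.
move=> hd df.
have dh' : differentiable h z by apply: differentiable_row => i; case: (hd i).
apply: fder_eq; first exact: fder_comp.
rewrite derive_partial//; apply: eq_bigr => i _; congr (_ * _).
by rewrite derive_row//; case: (hd i).
Qed.

Lemma fder_coord n (z v : 'rV[R]_n) i : fder z v (fun x => x 0 i) (v 0 i).
Proof.
have dx := differentiable_coord z 0 i; split => //.
by rewrite -derive_row ?derive_id.
Qed.

End Coordinates.

Section MatrixDerivative.
Context {R : realType} {V : normedModType R}.
Implicit Types (z v : V).

Definition mder z v m n (F : V -> 'M[R]_(m, n)) (dF : 'M[R]_(m, n)) : Prop :=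
  forall i j, fder z v (fun x => F x i j) (dF i j).

Lemma mder_eq z v m n (F : V -> 'M[R]_(m, n)) dF dF' :
  mder z v F dF -> dF = dF' -> mder z v F dF'.
Proof. by move=> ? <-. Qed.

Lemma mder_unique z v m n (F : V -> 'M[R]_(m, n)) dF dF' :
  mder z v F dF -> mder z v F dF' -> dF = dF'.
Proof.
by move=> h h'; apply/matrixP => i j; case: (h i j) => _ <-; case: (h' i j).
Qed.

Lemma near_eq_mder z v m n (F G : V -> 'M[R]_(m, n)) dF :
  {near z, F =1 G} -> mder z v F dF -> mder z v G dF.
Proof.
move=> FG h i j; apply: near_eq_fder (h i j).
by apply: filterS FG => x ->.
Qed.

Lemma mder_cst z v m n (A : 'M[R]_(m, n)) : mder z v (fun=> A) 0.
Proof. by move=> i j; rewrite mxE; exact: fder_cst. Qed.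

Lemma mderD z v m n (F G : V -> 'M[R]_(m, n)) dF dG :
  mder z v F dF -> mder z v G dG -> mder z v (fun x => F x + G x) (dF + dG).
Proof.
move=> hF hG i j; under eq_fun do rewrite mxE; rewrite mxE.
exact: fderD.
Qed.

Lemma mderZ z v m n (f : V -> R) (F : V -> 'M[R]_(m, n)) df dF :
  fder z v f df -> mder z v F dF ->
  mder z v (fun x => f x *: F x) (df *: F z + f z *: dF).
Proof.
move=> hf hF i j; under eq_fun do rewrite mxE; rewrite !mxE.
exact: fderM.
Qed.

Lemma mderM z v m n p (F : V -> 'M[R]_(m, n)) (G : V -> 'M[R]_(n, p)) dF dG :
  mder z v F dF -> mder z v G dG ->
  mder z v (fun x => F x *m G x) (dF *m G z + F z *m dG).
Proof.
move=> hF hG i j; under eq_fun do rewrite mxE.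
apply: fder_eq; last by rewrite !mxE -big_split.
by apply: fder_sum => k _; exact: fderM.
Qed.

Lemma mderT z v m n (F : V -> 'M[R]_(m, n)) dF :
  mder z v F dF -> mder z v (fun x => (F x)^T) dF^T.
Proof. by move=> hF i j; under eq_fun do rewrite mxE; rewrite mxE. Qed.

Lemma mder_sum z v m n (I : Type) (r : seq I) (P : pred I)
    (F : I -> V -> 'M[R]_(m, n)) dF :
  (forall i, P i -> mder z v (F i) (dF i)) ->
  mder z v (fun x => \sum_(i <- r | P i) F i x) (\sum_(i <- r | P i) dF i).
Proof.
move=> hF i j; under eq_fun do rewrite summxE; rewrite summxE.
by apply: fder_sum => k Pk; exact: hF.
Qed.

Lemma mder_block z v m1 m2 n1 n2 (A : V -> 'M[R]_(m1, n1))
    (B : V -> 'M[R]_(m1, n2)) (C : V -> 'M[R]_(m2, n1)) (D : V -> 'M[R]_(m2, n2))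
    dA dB dC dD :
  mder z v A dA -> mder z v B dB -> mder z v C dC -> mder z v D dD ->
  mder z v (fun x => block_mx (A x) (B x) (C x) (D x)) (block_mx dA dB dC dD).
Proof.
move=> hA hB hC hD i j.
case: (split_ordP i) => i' ->; case: (split_ordP j) => j' ->.
- by under eq_fun do rewrite block_mxEul; rewrite block_mxEul.
- by under eq_fun do rewrite block_mxEur; rewrite block_mxEur.
- by under eq_fun do rewrite block_mxEdl; rewrite block_mxEdl.
- by under eq_fun do rewrite block_mxEdr; rewrite block_mxEdr.
Qed.

End MatrixDerivative.

(** * Symmetry of second derivatives *)

Section Schwarz.
Context {R : realType} {V : normedModType R}.
Implicit Types (x u v : V) (f : V -> R).

Lemma is_derive_line f u c (s : R) : differentiable f (s *: u + c) ->
  is_derive s 1 (fun r => f (r *: u + c)) ('D_u f (s *: u + c)).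
Proof.
move=> df.
have E : (fun h : R => h^-1 *: (f ((h *: 1 + s) *: u + c) - f (s *: u + c))) =
         (fun h : R => h^-1 *: (f (h *: u + (s *: u + c)) - f (s *: u + c))).
  by apply/funext => h; rewrite [h *: 1]mulr1 scalerDl addrA.
have du : derivable f (s *: u + c) u by exact: diff_derivable.
by split; rewrite /derivable /derive E.
Qed.

(** Symmetric in u and v; after division by the square of h it approximates both mixed second
    derivatives. *)
Definition second_difference f x u v (h : R) : R :=
  f (h *: u + (h *: v + x)) - f (h *: u + x) - f (h *: v + x) + f x.

Lemma second_differenceC f x u v h :
  second_difference f x u v h = second_difference f x v u h.
Proof.
by rewrite /second_difference addrCA -!addrA; congr (_ + _); rewrite addrCA.
Qed.

(** The mean value theorem turns the second difference into h times an increment of ['D_u f] between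
    two points near x, and the expansion of ['D_u f] at x evaluates that increment.
    Differentiability of ['D_u f] at x itself is enough; continuity of second derivatives does not
    enter. *)
Lemma second_difference_approx f x u v (e : R) :
  (\forall y \near x, differentiable f y) -> differentiable ('D_u f) x ->
  0 < e -> \forall h \near 0^'+,
    `|second_difference f x u v h - h ^+ 2 * 'D_v ('D_u f) x| <= e * h ^+ 2.
Proof.
move=> df dDf e0; set F := 'D_u f; pose L := 'd F x.
(* For 0 <= a, b <= h the vector a u + b v has norm at most h K, and the summand 1 keeps K positive.
   Two errors of rate e / (2 K) then add up to e h, and the outer factor h gives e h^2. *)
pose K := `|u| + `|v| + 1.
have K0 : 0 < K by rewrite ltr_wpDl// addr_ge0.
have e'0 : 0 < e / (2 * K) by rewrite divr_gt0// mulr_gt0.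
have approx : \forall w \near (0 : V), `|F (w + x) - (F x + L w)| <= e / (2 * K) * `|w|.
  by have /eqaddoP/(_ _ e'0) := diff_locally dDf.
have df0 : \forall w \near (0 : V), differentiable f (w + x).
  by move: df; rewrite (near_shift 0 x); apply: filterS => w /=; rewrite subr0.
have [r /= r0 rP] : exists2 r : R, 0 < r & forall w, `|w| < r ->
    `|F (w + x) - (F x + L w)| <= e / (2 * K) * `|w| /\ differentiable f (w + x).
  have : \forall w \near (0 : V), `|F (w + x) - (F x + L w)| <= e / (2 * K) * `|w|
      /\ differentiable f (w + x) by near=> w; split; near: w.
  move=> /nbhs_normP[r r0 rP]; exists r => // w wr; apply: rP.
  by rewrite /ball_/= sub0r normrN.
have rK0 : 0 < r / K by rewrite divr_gt0.
near=> h.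
have h0 : 0 < h by [].
have hr : h < r / K by near: h; exact: nbhs_right_lt.
have small a b : 0 <= a <= h -> 0 <= b <= h ->
    `|a *: u + b *: v| <= h * K /\ `|a *: u + b *: v| < r.
  move=> /andP[a0 ah] /andP[b0 bh].
  have le1 : `|a *: u + b *: v| <= h * K.
    rewrite (le_trans (ler_normD _ _))// !normrZ !ger0_norm// /K !mulrDr mulr1.
    by rewrite ler_wpDr ?(ltW h0)// lerD// ler_wpM2r.
  by split=> //; rewrite (le_lt_trans le1)// -ltr_pdivlMr.
(* The second difference is the increment of [phi] over [0, h]. *)
pose phi s := f (s *: u + (h *: v + x)) - f (s *: u + x).
have dphi s : 0 <= s <= h ->
    is_derive s 1 phi (F (s *: u + (h *: v + x)) - F (s *: u + x)).
  move=> sh; apply: is_deriveB; apply: is_derive_line.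
    rewrite addrA; apply: (rP _ _).2; apply: (small _ _ _ _).2 => //.
    by rewrite lexx ltW.
  rewrite -[s *: u]addr0 -(scale0r v); apply: (rP _ _).2.
  by apply: (small _ _ _ _).2; rewrite // lexx ltW.
have [c ch phiE] : exists2 c, c \in `]0, h[ &
    phi h - phi 0 = (F (c *: u + (h *: v + x)) - F (c *: u + x)) * (h - 0).
  apply: MVT => //.
    by move=> s; rewrite in_itv/= => /andP[/ltW s0 /ltW sh]; apply: dphi; rewrite s0.
  apply: derivable_within_continuous => s; rewrite in_itv/= => sh.
  by have [] := dphi s sh.
have /andP[c0 ch'] : 0 <= c <= h.
  by move: ch; rewrite in_itv/= => /andP[/ltW -> /ltW ->].
have ch'' : 0 <= c <= h by rewrite c0.
have [hh0 hhh] : 0 <= h <= h /\ 0 <= (0 : R) <= h by rewrite !lexx (ltW h0).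
have -> : second_difference f x u v h = phi h - phi 0.
  rewrite /second_difference /phi !scale0r !add0r.
  by ring.
rewrite phiE subr0 deriveE//.
have [b1 s1] := small c h ch'' hh0; have [b2 s2] := small c 0 ch'' hhh.
have [a1 _] := rP _ s1; have [a2 _] := rP _ s2.
have LD s t : L (s *: u + t *: v) = s * L u + t * L v by rewrite /L linearD/= !linearZ.
have {}a1 : `|F (c *: u + (h *: v + x)) - (F x + (c * L u + h * L v))|
    <= e / (2 * K) * `|c *: u + h *: v|.
  by move: a1; rewrite LD -[_ + _ + x]addrA.
have {}a2 : `|F (c *: u + x) - (F x + c * L u)| <= e / (2 * K) * `|c *: u|.
  by move: a2; rewrite LD scale0r mul0r !addr0.
set A := F _ in a1 *; set B := F (c *: u + x) in a2 *.
rewrite -/L.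
have -> : (A - B) * h - h ^+ 2 * L v =
   h * ((A - (F x + (c * L u + h * L v))) - (B - (F x + c * L u))) by ring.
rewrite normrM gtr0_norm// expr2 mulrCA ler_pM2l//.
rewrite (le_trans (ler_normB _ _))//.
rewrite scale0r addr0 in b2.
rewrite (le_trans (lerD a1 a2))//.
rewrite (le_trans (lerD (ler_wpM2l (ltW e'0) b1) (ler_wpM2l (ltW e'0) b2)))//.
rewrite le_eqVlt; apply/orP; left; apply/eqP; field.
by rewrite gt_eqF.
Unshelve. all: by end_near. Qed.

(** Both mixed derivatives, multiplied by h^2, lie within (e / 2) h^2 of the same symmetric second
    difference, so they differ by at most e for every e > 0. *)
Lemma schwarz f x u v :
  (\forall y \near x, differentiable f y) ->
  differentiable ('D_u f) x -> differentiable ('D_v f) x ->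
  'D_v ('D_u f) x = 'D_u ('D_v f) x.
Proof.
move=> df du dv; apply/eqP; rewrite -subr_eq0 -normr_le0; apply/ler_addgt0Pr => e e0; rewrite add0r.
have e20 : 0 < e / 2 by rewrite divr_gt0.
have Auv := second_difference_approx v df du e20.
have Avu := second_difference_approx u df dv e20.
move: ('D_v ('D_u f) x) ('D_u ('D_v f) x) Auv Avu => a b Auv Avu.
have h0' : \forall h \near (0 : R)^'+, 0 < h by exact: nbhs_right_gt.
have [|h [[A B] h0]] := @filter_ex _ _ _ _ (filterI (filterI Auv Avu) h0').
  exact: at_right_proper_filter.
have h20 : 0 < h ^+ 2 by rewrite exprn_gt0.
rewrite -(ler_pM2l h20) -[X in X * `|_|]gtr0_norm// -normrM.
rewrite second_differenceC in B; set S := second_difference _ _ _ _ _ in A B.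
have -> : h ^+ 2 * (a - b) = (S - h ^+ 2 * b) - (S - h ^+ 2 * a) by ring.
rewrite (le_trans (ler_normB _ _))// (le_trans (lerD B A))//.
by rewrite -mulrDl -splitr mulrC.
Qed.

End Schwarz.

(** * Functions with finitely many derivatives on an open set *)

Section FiniteSmoothness.
Context {R : realType} {n : nat}.
Implicit Types (U : set 'rV[R]_n) (f g : 'rV[R]_n -> R).

(** Every iterated partial derivative of order below k is Frechet differentiable on U. A finite
    order lets closure under the algebraic operations be proved by induction on k, the derivative of
    a product or an inverse being built from functions of order k and k - 1. *)
Fixpoint Ck k U f : Prop :=
  if k is k'.+1 then
    (forall x, U x -> differentiable f x) /\ forall i, Ck k' U (partial i f)
  else True.

Lemma smooth_Ck k U f : smooth_on U f -> Ck k U f.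
Proof.
elim: k f => // k IH f sf; split=> [|i]; first exact: (sf [::]).
by apply: IH => s x Ux; have := sf (rcons s i) x Ux; rewrite foldr_rcons.
Qed.

Lemma Ck_differentiable k U f x : Ck k.+1 U f -> U x -> differentiable f x.
Proof. by case=> + _; apply. Qed.

Lemma Ck_partial k U f i : Ck k.+1 U f -> Ck k U (partial i f).
Proof. by case=> _; apply. Qed.

Lemma CkW k U f : Ck k.+1 U f -> Ck k U f.
Proof. by elim: k f => // k IH f [df pf]; split=> // i; exact: IH. Qed.

Lemma Ck_eq k U f g : open U -> (forall x, U x -> f x = g x) -> Ck k U f -> Ck k U g.
Proof.
move=> oU; elim: k f g => // k IH f g fg [df pf].
have nfg x : U x -> \forall y \near x, f y = g y.
  by move=> Ux; apply: filterS (open_nbhs_nbhs (conj oU Ux)) => y /fg.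
split=> [x Ux|i].
  by apply: near_eq_differentiable (df x Ux); exact: nfg.
by apply: IH (pf i) => x Ux; apply: near_eq_derive; exact: nfg.
Qed.

(** The inductive step of the closure lemmas. Since U is open, formulas for the partial derivatives
    are needed on U only. *)
Lemma Ck_step k U f (df : 'I_n -> 'rV[R]_n -> R) : open U ->
  (forall i x, U x -> fder x (delta_mx 0 i) f (df i x)) ->
  (forall x, U x -> differentiable f x) ->
  (forall i, Ck k U (df i)) -> Ck k.+1 U f.
Proof.
move=> oU fdf Df Cdf; split=> // i; apply: Ck_eq (Cdf i) => // x Ux.
by rewrite /partial (fderE (fdf i x Ux)).
Qed.

Lemma Ck_cst k U (c : R) : open U -> Ck k U (fun=> c).
Proof.
move=> oU; elim: k c => // k IH c; apply: (Ck_step (df := fun _ _ => 0)) => //.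
by move=> i x _; exact: fder_cst.
Qed.

Lemma fder_partial k U f i x : Ck k.+1 U f -> U x ->
  fder x (delta_mx 0 i) f (partial i f x).
Proof. by move=> Cf Ux; split=> //; exact: Ck_differentiable Cf Ux. Qed.

Lemma CkD k U f g : open U -> Ck k U f -> Ck k U g -> Ck k U (fun x => f x + g x).
Proof.
move=> oU; elim: k f g => // k IH f g Cf Cg.
apply: (Ck_step (df := fun i x => partial i f x + partial i g x)) => //.
- by move=> i x Ux; apply: fderD; [exact: (fder_partial _ Cf Ux)|exact: (fder_partial _ Cg Ux)].
- by move=> x Ux; apply: differentiableD; [exact: Ck_differentiable Cf Ux|exact: Ck_differentiable Cg Ux].
- by move=> i; apply: IH; exact: Ck_partial.
Qed.

Lemma CkM k U f g : open U -> Ck k U f -> Ck k U g -> Ck k U (fun x => f x * g x).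
Proof.
move=> oU; elim: k f g => // k IH f g Cf Cg.
apply: (Ck_step (df := fun i x => partial i f x * g x + f x * partial i g x)) => //.
- by move=> i x Ux; apply: fderM; [exact: (fder_partial _ Cf Ux)|exact: (fder_partial _ Cg Ux)].
- by move=> x Ux; apply: differentiableM; [exact: Ck_differentiable Cf Ux|exact: Ck_differentiable Cg Ux].
- move=> i; apply: CkD => //; apply: IH; try exact: Ck_partial; exact: CkW.
Qed.

Lemma CkN k U f : open U -> Ck k U f -> Ck k U (fun x => - f x).
Proof.
move=> oU Cf; apply: (Ck_eq (f := fun x => -1 * f x)) => //.
  by move=> x _; rewrite mulN1r.
by apply: CkM => //; exact: Ck_cst.
Qed.

Lemma CkV k U f : open U -> (forall x, U x -> f x != 0) -> Ck k U f ->
  Ck k U (fun x => (f x)^-1).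
Proof.
move=> oU f0; elim: k f f0 => // k IH f f0 Cf.
have CfV : Ck k U (fun x => (f x)^-1) by apply: IH => //; exact: CkW.
apply: (Ck_step (df := fun i x => - partial i f x * ((f x)^-1 * (f x)^-1))) => //.
- move=> i x Ux; have := fder_partial i Cf Ux => /fderV/(_ (f0 _ Ux)) /fder_eq.
  by apply; rewrite expr2 invfM.
- by move=> x Ux; apply: differentiableV; [exact: Ck_differentiable Cf Ux|exact: f0].
- by move=> i; apply: CkM => //; [apply: CkN => //; exact: Ck_partial|exact: CkM].
Qed.

Lemma Ck_sum k U (I : Type) (r : seq I) (P : pred I) (F : I -> 'rV[R]_n -> R) :
  open U -> (forall i, Ck k U (F i)) -> Ck k U (fun x => \sum_(i <- r | P i) F i x).
Proof.
move=> oU CF; elim: r => [|i r IH].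
  by under eq_fun do rewrite big_nil; exact: Ck_cst.
by under eq_fun do rewrite big_cons; case: (P i) => //; exact: CkD.
Qed.

Lemma Ck_prod k U (I : Type) (r : seq I) (P : pred I) (F : I -> 'rV[R]_n -> R) :
  open U -> (forall i, Ck k U (F i)) -> Ck k U (fun x => \prod_(i <- r | P i) F i x).
Proof.
move=> oU CF; elim: r => [|i r IH].
  by under eq_fun do rewrite big_nil; exact: Ck_cst.
by under eq_fun do rewrite big_cons; case: (P i) => //; exact: CkM.
Qed.

Lemma Ck_det k U m (A : 'rV[R]_n -> 'M[R]_m) : open U ->
  (forall i j, Ck k U (fun x => A x i j)) -> Ck k U (fun x => \det (A x)).
Proof.
move=> oU CA; apply: Ck_sum => // s; apply: CkM => //; first exact: Ck_cst.
exact: Ck_prod.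
Qed.

(** By Cramer's formula the entries are cofactors divided by the determinant. *)
Lemma Ck_invmx k U m (A : 'rV[R]_n -> 'M[R]_m) : open U ->
  (forall x, U x -> A x \in unitmx) -> (forall i j, Ck k U (fun x => A x i j)) ->
  forall i j, Ck k U (fun x => invmx (A x) i j).
Proof.
move=> oU uA CA i j.
apply: (Ck_eq (f := fun x => (\det (A x))^-1 * ((-1) ^+ (j + i) *
    \det (row' j (col' i (A x)))))) => //.
  by move=> x Ux; rewrite /invmx uA// !mxE.
apply: CkM => //; first apply: CkV => //.
- by move=> x /uA; rewrite unitmxE unitfE.
- exact: Ck_det.
- apply: CkM => //; first exact: Ck_cst.
  by apply: Ck_det => // a b; under eq_fun do rewrite !mxE; exact: CA.
Qed.

Lemma partialC U f i j x : open U -> Ck 2 U f -> U x ->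
  partial i (partial j f) x = partial j (partial i f) x.
Proof.
move=> oU [df Cf] Ux; apply: schwarz.
- by apply: filterS (open_nbhs_nbhs (conj oU Ux)) => y /df.
- by case: (Cf j) => + _; exact.
- by case: (Cf i) => + _; exact.
Qed.

End FiniteSmoothness.

(** * Derivatives in the splitting of coordinates into base and fibre parts *)

Section Products.
Context {R : realType} {m n : nat}.

Lemma lsubmx_delta_lshift (i : 'I_m) :
  lsubmx (delta_mx 0 (lshift n i) : 'rV[R]_(m + n)) = delta_mx 0 i.
Proof. by apply/rowP => j; rewrite !mxE eq_lshift. Qed.

Lemma lsubmx_delta_rshift (i : 'I_n) :
  lsubmx (delta_mx 0 (rshift m i) : 'rV[R]_(m + n)) = 0.
Proof. by apply/rowP => j; rewrite !mxE eq_lrshift. Qed.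

Lemma rsubmx_delta_lshift (i : 'I_m) :
  rsubmx (delta_mx 0 (lshift n i) : 'rV[R]_(m + n)) = 0.
Proof. by apply/rowP => j; rewrite !mxE eq_rlshift. Qed.

Lemma rsubmx_delta_rshift (i : 'I_n) :
  rsubmx (delta_mx 0 (rshift m i) : 'rV[R]_(m + n)) = delta_mx 0 i.
Proof. by apply/rowP => j; rewrite !mxE eq_rshift. Qed.

Lemma derive_comp_lsubmx (f : 'rV[R]_m -> R) (z v : 'rV[R]_(m + n)) :
  'D_v (fun w => f (lsubmx w)) z = 'D_(lsubmx v) f (lsubmx z).
Proof.
rewrite /derive; set L := (fun h : R => _); set M := (fun h : R => _).
suff -> : L = M by [].
by apply/funext => h; rewrite /L /M/= !linearD/= !linearZ.
Qed.

Lemma fder_comp_lsubmx (f : 'rV[R]_m -> R) (z v : 'rV[R]_(m + n)) :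
  differentiable f (lsubmx z) ->
  fder z v (fun w => f (lsubmx w)) ('D_(lsubmx v) f (lsubmx z)).
Proof.
move=> df; split; last exact: derive_comp_lsubmx.
by apply: (differentiable_comp (f := lsubmx)) => //; exact: differentiable_lsubmx.
Qed.

Lemma Ck_comp_lsubmx k (U : set 'rV[R]_m) (f : 'rV[R]_m -> R) :
  open U -> Ck k U f ->
  Ck k [set z : 'rV[R]_(m + n) | U (lsubmx z)] (fun z => f (lsubmx z)).
Proof.
move=> oU; have oU' : open [set z : 'rV[R]_(m + n) | U (lsubmx z)].
  by apply: open_comp => // x _; exact: continuous_lsubmx.
elim: k f => // k IH f [df Cf]; split=> [z Uz|i].
  by have [] := fder_comp_lsubmx 0 (df _ Uz).
case: (split_ordP i) => i' ->.
  apply: (Ck_eq _ _ (IH _ (Cf i'))) => // z Uz.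
  by rewrite /partial derive_comp_lsubmx lsubmx_delta_lshift.
apply: (Ck_eq (f := fun=> 0)) => //; last exact: Ck_cst.
by move=> z Uz; rewrite /partial derive_comp_lsubmx lsubmx_delta_rshift derive0.
Qed.

Lemma fder_coord_rsubmx (z v : 'rV[R]_(m + n)) i :
  fder z v (fun w => rsubmx w 0 i) (rsubmx v 0 i).
Proof.
by under eq_fun do rewrite mxE; rewrite mxE; exact: fder_coord.
Qed.

Lemma Ck_coord_rsubmx k (U : set 'rV[R]_(m + n)) i : open U ->
  Ck k U (fun w => rsubmx w 0 i).
Proof.
move=> oU; case: k => // k.
apply: (Ck_step (df := fun j _ => rsubmx (delta_mx 0 j : 'rV[R]_(m + n)) 0 i)) => //.
- by move=> j x _; exact: fder_coord_rsubmx.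
- by move=> x _; have [] := fder_coord_rsubmx x 0 i.
- by move=> j; exact: Ck_cst.
Qed.

(** The embedding of the zero section is linear, so the two difference quotients are the same
    function and no differentiability is involved. *)
Lemma partial_zero_section (F : 'rV[R]_(m + n) -> R) x (i : 'I_m) :
  partial (lshift n i) F (row_mx x 0) = partial i (fun x => F (row_mx x 0)) x.
Proof.
rewrite /partial /derive; set L := (fun h : R => _); set M := (fun h : R => _).
suff -> : L = M by [].
apply/funext => h; rewrite /L /M/=; congr (_ *: (F _ - _)).
rewrite -[delta_mx 0 (lshift n i)]hsubmxK lsubmx_delta_lshift rsubmx_delta_lshift.
by rewrite scale_row_mx add_row_mx scaler0 addr0.
Qed.

End Products.

(** * Derivatives on the half line *)

Section HalfDerivative.
Context {R : realType}.
Implicit Types (f g : R -> R) (t d c : R).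

(* The one-sided derivative at [0] and the two-sided one elsewhere: [d] is the
   derivative of [f : [0, +oo[ -> R] at [t] iff [f] agrees on [0, +oo[ with a
   function derivable at [t].  The usual rules are thus inherited from those of
   two-sided derivatives. *)
Definition hder f t d : Prop :=
  exists2 F, is_derive t 1 F d & forall s, 0 <= s -> F s = f s.

Lemma is_derive_quotientP f t d : is_derive t 1 f d <->
  forall e, 0 < e -> exists2 r, 0 < r & forall s, s != t -> `|s - t| < r ->
    `|d - (f s - f t) / (s - t)| < e.
Proof.
have E h : h^-1 *: (f (h *: 1 + t) - f t) = (f (h + t) - f t) / (h + t - t).
  by rewrite addrK mulrC [h *: 1]mulr1.
have cvgE : is_derive t 1 f d <->
    (h^-1 *: (f (h *: 1 + t) - f t) @[h --> 0^'] --> d).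
  split=> [[fd <-]|fd]; first exact: fd.
  by split; [apply/cvg_ex; exists d|exact: cvg_lim].
rewrite cvgE; split.
  move=> /cvgrPdist_lt fd e e0; have [r /= r0 rP] := fd e e0.
  exists r => // s st sr.
  have := rP (s - t); rewrite E subrK; apply.
    by rewrite /= sub0r normrN.
  by rewrite subr_eq0.
move=> fd; apply/cvgrPdist_lt => e e0; have [r r0 rP] := fd e e0.
exists r => // h /= + h0; rewrite sub0r normrN => hr.
by rewrite E; apply: rP; rewrite ?addrK// -subr_eq0 addrK.
Qed.

Lemma half_quotient_cvgP f t d : half_quotient f t --> d <->
  forall e, 0 < e -> exists2 r, 0 < r & forall s, 0 <= s -> s != t -> `|s - t| < r ->
    `|d - (f s - f t) / (s - t)| < e.
Proof.
split.
  move=> /cvgrPdist_lt fd e e0; have [r /= r0 rP] := fd e e0.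
  exists r => // s s0 st sr; apply: rP => //.
  by rewrite /= distrC.
move=> fd; apply/cvgrPdist_lt => e e0; have [r r0 rP] := fd e e0.
exists r => // s /= + st s0; rewrite distrC => sr.
exact: rP.
Qed.

Lemma within_half_line_proper t : 0 <= t -> ProperFilter (within [set s | 0 <= s] t^').
Proof.
move=> t0; apply: Build_ProperFilter_ex => P [r /= r0 rP].
exists (t + r / 2); have r20 : 0 < r / 2 by rewrite divr_gt0.
apply: rP.
- by rewrite /= opprD addNKr normrN gtr0_norm// ltr_pdivrMr// ltr_pMr// ltr1n.
- by rewrite -subr_eq0 addrAC subrr add0r gt_eqF.
- by rewrite /= addr_ge0// ltW.
Qed.

Lemma hder_half_deriv f t d : 0 <= t -> hder f t d -> half_deriv f t = d.
Proof.
move=> t0 [F /is_derive_quotientP Fd Ff].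
have pf := within_half_line_proper t0.
apply: cvg_lim => //.
apply/half_quotient_cvgP => e /Fd[r r0 rP]; exists r => // s s0 st sr.
by rewrite -!Ff//; exact: rP.
Qed.

Lemma hder_of_cvg f t : 0 <= t -> cvg (half_quotient f t) -> hder f t (half_deriv f t).
Proof.
move=> t0 /half_quotient_cvgP fd; set d := lim _ in fd.
rewrite -[half_deriv f t]/d.
(* On the negative side f is continued by the line of slope d through its value at t; the difference
   quotient there is constantly d. *)
exists (fun s => if 0 <= s then f s else f t + d * (s - t)); last by move=> s ->.
apply/is_derive_quotientP => e e0; have [r r0 rP] := fd e e0; exists r => // s st sr.
rewrite t0; case: ifPn => s0; first exact: rP.
have st0 : s - t != 0 by rewrite subr_eq0.
by rewrite addrAC subrr add0r mulfK// subrr normr0.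
Qed.

Lemma hder_eq f t d d' : hder f t d -> d = d' -> hder f t d'.
Proof. by move=> ? <-. Qed.

Lemma hder_id t : hder id t 1.
Proof. by exists id => //; exact: is_derive_id. Qed.

Lemma hderD f g t df dg : hder f t df -> hder g t dg ->
  hder (fun s => f s + g s) t (df + dg).
Proof.
move=> [F dF Ff] [G dG Gg]; exists (F + G); first exact: is_deriveD.
by move=> s s0; rewrite fctE Ff// Gg.
Qed.

Lemma hderM f g t df dg : 0 <= t -> hder f t df -> hder g t dg ->
  hder (fun s => f s * g s) t (df * g t + f t * dg).
Proof.
move=> t0 [F dF Ff] [G dG Gg]; exists (F * G); last first.
  by move=> s s0; rewrite fctE Ff// Gg.
rewrite -Ff// -Gg// addrC [df * _]mulrC; exact: is_deriveM.
Qed.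

Lemma hder_comp (h f : R -> R) t d dh : 0 <= t -> hder f t d ->
  is_derive (f t) 1 h dh -> hder (h \o f) t (dh * d).
Proof.
move=> t0 [F dF Ff]; rewrite -Ff// => hd; exists (h \o F).
  exact: is_derive1_comp.
by move=> s s0 /=; rewrite Ff.
Qed.

Lemma hder_cst t c : hder (fun=> c) t 0.
Proof. by exists (fun=> c) => //; exact: is_derive_cst. Qed.

Lemma hderMl f t c d : 0 <= t -> hder f t d -> hder (fun s => c * f s) t (c * d).
Proof.
by move=> t0 /(hderM t0 (hder_cst t c)) /hder_eq; apply; rewrite mul0r add0r.
Qed.

Lemma hderB f g t df dg : 0 <= t -> hder f t df -> hder g t dg ->
  hder (fun s => f s - g s) t (df - dg).
Proof.
move=> t0 hf /(hderMl (-1) t0) hg; have [F hF EF] := hderD hf hg.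
by rewrite mulN1r in hF; exists F => // s s0; rewrite EF// mulN1r.
Qed.

Lemma hder_div f g t df dg : 0 <= t -> hder f t df -> hder g t dg -> g t != 0 ->
  hder (fun s => f s / g s) t ((df * g t - f t * dg) / g t ^+ 2).
Proof.
move=> t0 hf hg g0; have hi := is_deriveV g0 (is_derive_id (g t) (1 : R)).
apply: hder_eq (hderM t0 hf (hder_comp t0 hg hi)) _.
by rewrite -[_ *: 1]/(_ * 1) /=; field.
Qed.

Lemma hder_add_mul_id f g t df dg : 0 <= t -> hder f t df -> hder g t dg ->
  hder (fun s => f s + s * g s) t (df + g t + t * dg).
Proof.
move=> t0 hf hg; apply: hder_eq (hderD hf (hderM t0 (hder_id t) hg)) _.
by rewrite mul1r addrA.
Qed.

(** A one-sided derivative suffices for the chain rule, even where q vanishes: the values of q near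
    z are nonnegative, so f may be replaced by its extension. With q = y.y this covers the zero
    section. *)
Lemma fder_half (V : normedModType R) (q : V -> R) z v f d dq :
  (\forall w \near z, 0 <= q w) -> fder z v q dq -> hder f (q z) d ->
  fder z v (fun w => f (q w)) (d * dq).
Proof.
move=> q0 hq [F dF Ff].
apply: near_eq_fder (fder_comp_real hq dF).
by apply: filterS q0 => w /Ff.
Qed.

End HalfDerivative.

Section CharacteristicFunctions.
Context {R : realType} (alpha beta : R -> R).
Context (smooth_alpha : half_smooth alpha) (smooth_beta : half_smooth beta).
Context (alpha_gt0 : forall t, 0 <= t -> 0 < alpha t).
Context (Delta_gt0 : forall t, 0 <= t -> 0 < Delta_fun alpha beta t).

Lemma half_smooth_hder f k t : half_smooth f -> 0 <= t ->
  hder (iter k (@half_deriv R) f) t (iter k.+1 (@half_deriv R) f t).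
Proof. by move=> sf t0; apply: hder_of_cvg => //; exact: sf. Qed.

(** The logarithm contributes alpha' / alpha + Delta' / Delta, and phi' = 2 alpha' + t alpha''. *)
Lemma H_funE t : 0 <= t -> H_fun alpha beta t =
  (alpha t + t * half_deriv alpha t) *
  (half_deriv alpha t / alpha t
   + (half_deriv alpha t + beta t + t * half_deriv beta t) / Delta_fun alpha beta t)
  - 2 * (2 * half_deriv alpha t + t * half_deriv (half_deriv alpha) t).
Proof.
move=> t0; have a0 := alpha_gt0 t0; have D0 := Delta_gt0 t0.
have ha := half_smooth_hder 0 smooth_alpha t0.
have ha1 := half_smooth_hder 1 smooth_alpha t0.
have hb := half_smooth_hder 0 smooth_beta t0.
rewrite /H_fun; congr (_ * _ - 2 * _).
  have aD0 : 0 < alpha t * Delta_fun alpha beta t by exact: mulr_gt0.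
  have hl := hder_comp t0 (hderM t0 ha (hder_add_mul_id t0 ha hb)) (is_derive1_ln aD0).
  rewrite (hder_half_deriv t0 hl) /=; move: a0 D0; rewrite /Delta_fun => a0 D0.
  by field; rewrite !gt_eqF.
rewrite (hder_half_deriv t0 (hder_add_mul_id t0 ha ha1)) /=; ring.
Qed.

End CharacteristicFunctions.

(** * Levi-Civita connection in coordinates *)

Local Opaque derive.

Section MatrixPartials.
Context {R : realType} {n : nat}.

Definition partial_mx m p k (F : 'rV[R]_n -> 'M[R]_(m, p)) x : 'M[R]_(m, p) :=
  \matrix_(i, j) partial k (fun y => F y i j) x.

Lemma mder_partial m p k (F : 'rV[R]_n -> 'M[R]_(m, p)) x :
  (forall i j, differentiable (fun y => F y i j) x) ->
  mder x (delta_mx 0 k) F (partial_mx k F x).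
Proof. by move=> dF i j; rewrite mxE; split. Qed.

Lemma partial_mxE m p k (F : 'rV[R]_n -> 'M[R]_(m, p)) x dF :
  mder x (delta_mx 0 k) F dF -> partial_mx k F x = dF.
Proof. by move=> FdF; apply/matrixP => i j; rewrite mxE; exact: fderE (FdF i j). Qed.

End MatrixPartials.

Section Connection.
Context {R : realType} {n : nat} (g : 'rV[R]_n -> 'M[R]_n).
Implicit Types (x : 'rV[R]_n) (i j k l : 'I_n).

(* Row convention: [w *m connection i x] is the contraction of [w] with
   [Gamma_(i k)^l]; hence the order of the products in [curvature_mx]. *)
Definition connection i x : 'M[R]_n := \matrix_(k, l) christoffel g i k l x.

Definition curvature_mx i j x : 'M[R]_n :=
  partial_mx i (connection j) x - partial_mx j (connection i) x
  + (connection j x *m connection i x - connection i x *m connection j x).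

Lemma curvature_mxE i j x : curvature_mx i j x = \matrix_(k, l) curvature g i j k l x.
Proof.
have E a b c : (fun y => connection a y b c) = christoffel g a b c.
  by apply/funext => y; rewrite mxE.
apply/matrixP => k l; rewrite !mxE /curvature sumrB !E.
by congr (_ + (_ - _)); apply: eq_bigr => m _; rewrite !mxE.
Qed.

Context (x : 'rV[R]_n) (gx_unit : g x \in unitmx) (g_sym : \forall y \near x, (g y)^T = g y).

Let gx_sym : (g x)^T = g x. Proof. exact: nbhs_singleton g_sym. Qed.

Lemma partial_metric_sym i j k :
  partial k (fun y => g y i j) x = partial k (fun y => g y j i) x.
Proof.
by apply: near_eq_derive; apply: filterS g_sym => y gy; rewrite -[in LHS]gy mxE.
Qed.

(** The Christoffel symbols of the first kind: multiplication by g cancels the inverse matrix in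
    [christoffel]. *)
Lemma connection_lower i j k : (connection k x *m g x) i j =
  2^-1 * (partial k (fun y => g y i j) x + partial i (fun y => g y k j) x
          - partial j (fun y => g y k i) x).
Proof.
have -> : connection k x = \matrix_(a, b) (2^-1 *
    (partial k (fun y => g y a b) x + partial a (fun y => g y k b) x
     - partial b (fun y => g y k a) x)) *m invmx (g x).
  apply/matrixP => a b; rewrite !mxE /christoffel mulr_sumr; apply: eq_bigr => l _.
  have -> : invmx (g x) b l = invmx (g x) l b.
    by rewrite -[in LHS]gx_sym -trmx_inv mxE.
  by rewrite !mxE mulrAC -mulrA.
by rewrite mulmxKV// mxE.
Qed.

(** The equation nabla g = 0 in matrix form. *)
Lemma metric_compat k :
  partial_mx k g x = connection k x *m g x + g x *m (connection k x)^T.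
Proof.
rewrite -[X in _ + X *m _]gx_sym -trmx_mul; apply/matrixP => i j.
rewrite [RHS]mxE [X in _ + X]mxE !connection_lower mxE.
rewrite (partial_metric_sym j i).
by field.
Qed.

Lemma connection_sym i j k : connection i x j k = connection j x i k.
Proof.
rewrite !mxE /christoffel; congr (_ * _); apply: eq_bigr => l _.
rewrite (partial_metric_sym j i); ring.
Qed.

(** Uniqueness of the Levi-Civita connection at one point. Metricity expresses each derivative of g
    as a sum of two lowered symbols of C; in the alternating sum of [connection_lower], symmetry of
    C cancels all but one of them, counted twice. It serves both for changes of charts and for the
    natural metric. *)
Lemma koszul (C : 'I_n -> 'M[R]_n) :
  (forall i j k, C i j k = C j i k) ->
  (forall k, partial_mx k g x = C k *m g x + g x *m (C k)^T) ->
  forall k, connection k x = C k.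
Proof.
move=> Csym Ccompat k; apply: (can_inj (mulmxK gx_unit)).
have dg a b c : partial a (fun y => g y b c) x = (C a *m g x) b c + (C a *m g x) c b.
  transitivity (partial_mx a g x b c); first by rewrite mxE.
  by rewrite Ccompat -[X in _ + X *m _]gx_sym -trmx_mul mxE [X in _ + X]mxE.
have lsym a b c : (C a *m g x) b c = (C b *m g x) a c.
  by rewrite !mxE; apply: eq_bigr => l _; rewrite Csym.
apply/matrixP => i j; rewrite connection_lower !dg.
rewrite (lsym i k j) (lsym j k i) (lsym j i k); by field.
Qed.

End Connection.

(** * Curvature in a moving frame *)

Section GaugeTransformation.
Context {R : realType} {n : nat} (g : 'rV[R]_n -> 'M[R]_n).
Context (W : set 'rV[R]_n) (oW : open W).
Context (P Q : 'rV[R]_n -> 'M[R]_n) (omega : 'I_n -> 'rV[R]_n -> 'M[R]_n).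
Context (PQ : forall z, W z -> P z *m Q z = 1%:M).
Context (CP : forall i j, Ck 2 W (fun z => P z i j)).
Context (dQ : forall i j z, W z -> differentiable (fun z => Q z i j) z).
Context (domega : forall e i j z, W z -> differentiable (fun z => omega e z i j) z).
(* [P] turns components along the coordinate fields into components in a moving
   frame, in which the covariant derivative is [d + omega]. *)
Context (gauge : forall e z, W z ->
  connection g e z *m P z = partial_mx e P z + P z *m omega e z).

Lemma antisym_cancel (a b c d e c' e' : 'M[R]_n) :
  a + b + c + (d + e) - (a + d + c' + (b + e')) = c - c' + (e - e').
Proof. by apply/matrixP => i j; rewrite !mxE; ring. Qed.

(** The gauge equation is differentiated once more. On antisymmetrising in e and f, the second
    derivatives of P cancel by Schwarz and the mixed terms, one derivative of P times [omega],
    cancel in pairs. *)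
Lemma gauge_curvature e f z : W z ->
  curvature_mx g e f z *m P z =
  P z *m (partial_mx e (omega f) z - partial_mx f (omega e) z
          + (omega f z *m omega e z - omega e z *m omega f z)).
Proof.
move=> Wz; have nW : \forall y \near z, W y by exact: open_nbhs_nbhs (conj oW Wz).
have dP a : mder z (delta_mx 0 a) P (partial_mx a P z).
  by apply: mder_partial => i j; case: (CP i j) => + _; exact.
have ddP a b : mder z (delta_mx 0 a) (partial_mx b P) (partial_mx a (partial_mx b P) z).
  apply: mder_partial => i j; under eq_fun do rewrite mxE.
  by have [_ /(_ b)[+ _]] := CP i j; exact.
have dom a b : mder z (delta_mx 0 a) (omega b) (partial_mx a (omega b) z).
  by apply: mder_partial => i j; exact: domega.
have pE b i j : (fun y => partial_mx b P y i j) = partial b (fun y => P y i j).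
  by apply/funext => y; rewrite mxE.
have ddPC : partial_mx e (partial_mx f P) z = partial_mx f (partial_mx e P) z.
  by apply/matrixP => i j; rewrite [LHS]mxE [RHS]mxE !pE (partialC _ _ oW (CP i j)).
have dQz a : mder z (delta_mx 0 a) Q (partial_mx a Q z).
  by apply: mder_partial => i j; exact: dQ.
have dR a b := mderD (ddP a b) (mderM (dP a) (dom a b)).
(* Differentiability of the connection is read off from the gauge equation multiplied by Q. *)
have dconn a b : mder z (delta_mx 0 a) (connection g b)
    (partial_mx a (connection g b) z).
  apply: mder_partial => i j.
  have E : {near z, (fun y => (partial_mx b P y + P y *m omega b y) *m Q y)
                    =1 connection g b}.
    by apply: filterS nW => y Wy; rewrite -(gauge b Wy) -mulmxA (PQ Wy) mulmx1.
  by have [] := near_eq_mder E (mderM (dR a b) (dQz a)) i j.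
have key a b : (partial_mx a (connection g b) z + connection g b z *m connection g a z)
    *m P z = partial_mx a (partial_mx b P) z + partial_mx a P z *m omega b z
    + P z *m partial_mx a (omega b) z
    + (partial_mx b P z + P z *m omega b z) *m omega a z.
  have E : {near z, (fun y => connection g b y *m P y) =1
                    (fun y => partial_mx b P y + P y *m omega b y)}.
    by apply: filterS nW => y Wy; rewrite (gauge b Wy).
  have := mder_unique (near_eq_mder E (mderM (dconn a b) (dP a))) (dR a b) => {}E.
  rewrite mulmxDl -mulmxA (gauge a Wz) mulmxDr addrA E mulmxA (gauge b Wz).
  by rewrite -!addrA.
rewrite /curvature_mx.
have -> : partial_mx e (connection g f) z - partial_mx f (connection g e) z
  + (connection g f z *m connection g e z - connection g e z *m connection g f z)
  = (partial_mx e (connection g f) z + connection g f z *m connection g e z)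
  - (partial_mx f (connection g e) z + connection g e z *m connection g f z).
  by rewrite addrACA opprD.
rewrite mulmxBl [X in X - _]key [X in _ - X]key ddPC.
move: (partial_mx e P z) (partial_mx f P z) (partial_mx f (partial_mx e P) z)
  (partial_mx e (omega f) z) (partial_mx f (omega e) z) (P z) (omega e z) (omega f z).
move=> Pe Pf Pfe fe ef p oe of'; rewrite !mulmxDl !mulmxDr !mulmxN !mulmxA.
exact: antisym_cancel.
Qed.

End GaugeTransformation.

(** * Geometry of the fibres *)

Section FibreAlgebra.
Context {R : realType} {n : nat} (g : 'M[R]_n).
Implicit Types (v w k l y : 'rV[R]_n).

Definition dot v w : R := (v *m g *m w^T) 0 0.

Lemma dotDl v v' w : dot (v + v') w = dot v w + dot v' w.
Proof. by rewrite /dot !mulmxDl mxE. Qed.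

Lemma dotZl (c : R) v w : dot (c *: v) w = c * dot v w.
Proof. by rewrite /dot -!scalemxAl mxE. Qed.

Lemma dotDr v w w' : dot v (w + w') = dot v w + dot v w'.
Proof. by rewrite /dot linearD/= mulmxDr mxE. Qed.

Lemma dotZr (c : R) v w : dot v (c *: w) = c * dot v w.
Proof. by rewrite /dot linearZ/= -scalemxAr mxE. Qed.

Lemma dotC v w : g^T = g -> dot v w = dot w v.
Proof.
move=> gs; have T (B : 'M[R]_1) : B 0 0 = B^T 0 0 by rewrite mxE.
by rewrite /dot T !trmx_mul trmxK gs mulmxA.
Qed.

Lemma bilinear_eq_mx (A B : 'M[R]_n) :
  (forall v w, (v *m A *m w^T) 0 0 = (v *m B *m w^T) 0 0) -> A = B.
Proof.
have E (C : 'M[R]_n) i j : ((delta_mx 0 i : 'rV_n) *m C *m (delta_mx 0 j : 'rV_n)^T) 0 0 = C i j.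
  by rewrite trmx_delta -rowE -colE !mxE.
by move=> AB; apply/matrixP => i j; rewrite -!E.
Qed.

Context (gs : g^T = g).

(* The fibre of the tangent bundle over a point carries the metric
   [alpha(t) v.w + beta(t) (v.y)(w.y)], [t = y.y].  With the coefficients
   [coef_a], [coef_b], [coef_d] below, its Christoffel symbols at [y] are
   [fibre_connection y a b d]. *)
Definition fibre_connection y (a b d : R) v w : 'rV[R]_n :=
  a *: (dot v y *: w + dot w y *: v)
  + (b * (dot v y * dot w y) + d * dot v w) *: y.

Definition fibre_connection_mx y (a b d : R) v : 'M[R]_n :=
  a *: ((dot v y)%:M + (g *m y^T) *m v)
  + (b * dot v y) *: ((g *m y^T) *m y) + d *: ((g *m v^T) *m y).

Lemma mul_gT_row w v y : w *m ((g *m v^T) *m y) = dot w v *: y.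
Proof.
rewrite !mulmxA [w *m g *m v^T]mx11_scalar mul_scalar_mx.
by [].
Qed.

Lemma mul_fibre_connection_mx y a b d v w :
  w *m fibre_connection_mx y a b d v = fibre_connection y a b d v w.
Proof.
rewrite /fibre_connection_mx !mulmxDr -!scalemxAr !mulmxDr !mul_gT_row mul_mx_scalar.
rewrite /fibre_connection (dotC v w gs) scalerDl !scalerA addrA.
by rewrite mulrA.
Qed.

Lemma fibre_connectionC y a b d v w :
  fibre_connection y a b d v w = fibre_connection y a b d w v.
Proof.
rewrite /fibre_connection (dotC v w gs) addrC [dot v y *: w + _]addrC.
by rewrite [dot v y * _]mulrC addrC.
Qed.

Lemma dot_fibre_connection y a b d v w k :
  dot (fibre_connection y a b d v w) k =
  a * (dot v y * dot w k + dot w y * dot v k)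
  + (b * (dot v y * dot w y) + d * dot v w) * dot y k.
Proof. by rewrite /fibre_connection !(dotDl, dotZl). Qed.

(* The derivative in [y], in direction [k], when [a], [b], [d] are functions of
   [y.y] with derivatives [a1], [b1], [d1]. *)
Definition fibre_connection_deriv y (a b d a1 b1 d1 : R) k v w : 'rV[R]_n :=
  (2 * a1 * dot k y) *: (dot v y *: w + dot w y *: v)
  + a *: (dot v k *: w + dot w k *: v)
  + (2 * b1 * dot k y * (dot v y * dot w y)
     + b * (dot v k * dot w y + dot v y * dot w k)
     + 2 * d1 * dot k y * dot v w) *: y
  + (b * (dot v y * dot w y) + d * dot v w) *: k.

(** The usual expression of R(k, l) v through Christoffel symbols, y being the point of the fibre at
    which they are taken. *)
Definition fibre_curvature y (a b d a1 b1 d1 : R) k l v : 'rV[R]_n :=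
  fibre_connection_deriv y a b d a1 b1 d1 k l v
  - fibre_connection_deriv y a b d a1 b1 d1 l k v
  + fibre_connection y a b d k (fibre_connection y a b d l v)
  - fibre_connection y a b d l (fibre_connection y a b d k v).

(** Antisymmetry in k and l leaves three tensors. The contribution 2 b1 (k.y)(l.y)(v.y) y is
    symmetric in k and l and cancels. *)
Lemma fibre_curvatureE y a b d a1 b1 d1 k l v (t := dot y y) :
  fibre_curvature y a b d a1 b1 d1 k l v =
  (- a + d + t * a * d) *: (dot l v *: k - dot k v *: l)
  + (2 * d1 - b + d * (b * t + d)) *: ((dot k y * dot l v - dot l y * dot k v) *: y)
  + (- 2 * a1 + b + a ^+ 2 + t * a * b) *: (dot v y *: (dot l y *: k - dot k y *: l)).
Proof.
have E k' w : fibre_connection y a b d k' w =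
   a *: (dot k' y *: w + dot w y *: k') + (b * (dot k' y * dot w y) + d * dot w k') *: y.
  by rewrite /fibre_connection (dotC k' w gs).
rewrite /fibre_curvature !(E _ (fibre_connection _ _ _ _ _ _)) !dot_fibre_connection.
rewrite /fibre_connection /fibre_connection_deriv -/t.
rewrite (dotC l k gs) (dotC v k gs) (dotC v l gs) (dotC y k gs) (dotC y l gs).
apply/rowP => j; rewrite !mxE.
move: (dot k y) (dot l y) (dot v y) (dot k l) (dot k v) (dot l v) t => ? ? ? ? ? ? ?.
by ring.
Qed.

End FibreAlgebra.

Lemma sum2E (V : nmodType) (F : 'I_2 -> V) : \sum_(i < 2) F i = F 0 + F 1.
Proof.
rewrite big_ord_recl big_ord1; congr (_ + F _); exact: val_inj.
Qed.

Section FibreCurvature.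
Context {R : realType} (g : 'M[R]_2) (gs : g^T = g).
Context (gpos : forall v : 'rV[R]_2, v != 0 -> 0 < dot g v v).
Context (al al1 al2 be be1 t : R) (al0 : 0 < al) (De0 : 0 < al + t * be).

Let De := al + t * be.
Let De1 := al1 + be + t * be1.

(** The coefficients solve the metricity of the fibre connection. Comparing the terms in (k.y)(v.w),
    (v.y)(k.w) and (k.y)(v.y)(w.y) in the derivative of the fibre metric along k gives alpha a =
    alpha', alpha a + Delta d = beta and Delta b + 2 beta a = beta'. *)
Definition coef_a := al1 / al.
Definition coef_b := be1 / De - 2 * al1 * be / (al * De).
Definition coef_d := (be - al1) / De.
(** [coef_a1] and [coef_d1] are the derivatives in t of [coef_a] and [coef_d]; [coef_H] is H with
    its derivatives expanded as in [H_funE]. *)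
Definition coef_a1 := (al2 * al - al1 ^+ 2) / al ^+ 2.
Definition coef_d1 := ((be1 - al2) * De - (be - al1) * De1) / De ^+ 2.
Definition coef_H :=
  (al + t * al1) * (al1 / al + De1 / De) - 2 * (2 * al1 + t * al2).

Let F1 := - coef_a + coef_d + t * coef_a * coef_d.
Let F2 := 2 * coef_d1 - coef_b + coef_d * (coef_b * t + coef_d).
Let F3 := - 2 * coef_a1 + coef_b + coef_a ^+ 2 + t * coef_a * coef_b.

Lemma coef_HE : al * (F1 + t * F3) = coef_H.
Proof.
rewrite /F1 /F3 /coef_H /coef_a /coef_b /coef_d /coef_a1 /De1 /De.
by field; rewrite !gt_eqF.
Qed.

(* The skew-symmetry of the curvature operator for the fibre metric. *)
Lemma coef_symm : (F1 + t * F2) * De = (F1 + t * F3) * al.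
Proof.
rewrite /F1 /F2 /F3 /coef_a /coef_b /coef_d /coef_a1 /coef_d1 /De1 /De.
by field; rewrite !gt_eqF.
Qed.

(* The antisymmetrisation over three vectors vanishes in dimension 2. *)
Lemma dim2_identity (y k l v : 'rV[R]_2) :
  dot g y y *: (dot g l v *: k - dot g k v *: l) =
  ((dot g k y * dot g l v - dot g l y * dot g k v) *: y)
  + dot g v y *: (dot g l y *: k - dot g k y *: l).
Proof.
have g10 : g 1 0 = g 0 1 by rewrite -[in LHS]gs mxE.
have E v' w' : dot g v' w' = v' 0 0 * w' 0 0 * g 0 0
    + (v' 0 0 * w' 0 1 + v' 0 1 * w' 0 0) * g 0 1 + v' 0 1 * w' 0 1 * g 1 1.
  rewrite /dot mxE sum2E !mxE !sum2E g10; ring.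
apply/rowP => j; rewrite !mxE !E.
have [->|->] : j = 0 \/ j = 1 by case: j => -[|[|//]] ?; [left|right]; exact: val_inj.
  ring.
ring.
Qed.

(** H = 0 gives F1 + t F3 = 0, and then F1 + t F2 = 0 by [coef_symm]. At y = 0 only the F1 term is
    left, and F1 = 0 because t = 0. *)
Lemma fibre_curvature_eq0 (y k l v : 'rV[R]_2) b1 : dot g y y = t -> coef_H = 0 ->
  fibre_curvature g y coef_a coef_b coef_d coef_a1 b1 coef_d1 k l v = 0.
Proof.
move=> yt; rewrite -coef_HE => /eqP; rewrite mulf_eq0 gt_eqF//= => /eqP H0.
have H0' : F1 + t * F2 = 0.
  by apply: (mulIf (x := De)); rewrite ?gt_eqF// coef_symm H0 !mul0r.
rewrite fibre_curvatureE// yt -/F1 -/F2 -/F3.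
have [y0|y0] := eqVneq y 0.
  have d0 w : dot g w 0 = 0 by rewrite /dot trmx0 mulmx0 mxE.
  have t00 : t = 0 by rewrite -yt y0 d0.
  move: H0; rewrite t00 mul0r addr0 => ->.
  by rewrite y0 !d0 !scale0r !scaler0 !addr0.
have tn0 : t != 0 by rewrite -yt gt_eqF// gpos.
have -> : F2 = - t^-1 * F1.
  by apply: (mulfI tn0); rewrite mulNr mulrN mulrA mulfV// mul1r; apply/eqP;
     rewrite -addr_eq0 addrC H0'.
have -> : F3 = - t^-1 * F1.
  by apply: (mulfI tn0); rewrite mulNr mulrN mulrA mulfV// mul1r; apply/eqP;
     rewrite -addr_eq0 addrC H0.
(* With F2 = F3 = - F1 / t the last two terms are a multiple of the right-hand side of
   [dim2_identity], whose left-hand side is t times the first tensor. *)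
rewrite -addrA -scalerDr -dim2_identity yt scalerA.
have -> : - t^-1 * F1 * t = - F1 by field.
by rewrite scaleNr subrr.
Qed.

Lemma exists_orthogonal (v : 'rV[R]_2) : v != 0 -> exists2 w, w != 0 & dot g w v = 0.
Proof.
move=> v0; pose u := v *m g.
(* The covector v g turned by a right angle. *)
exists (\row_j (if j == 0 then u 0 1 else - u 0 0)).
  apply: contraL (gpos v0) => /eqP/rowP w0.
  suff u0 : u = 0 by rewrite /dot -/u u0 mul0mx mxE ltxx.
  have u1 : u 0 1 = 0 by have := w0 0; rewrite !mxE.
  have u00 : u 0 0 = 0 by have := w0 1; rewrite !mxE/= => /eqP; rewrite oppr_eq0 => /eqP.
  apply/rowP => j; rewrite [RHS]mxE.
  by have [->|->] : j = 0 \/ j = 1 by case: j => -[|[|//]] ?; [left|right]; exact: val_inj.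
rewrite dotC// /dot -/u mxE sum2E !mxE/=; ring.
Qed.

(** For y nonzero the test vectors are k = v = y and l orthogonal to y, which give - (F1 + t F3) t
    l. At y = 0 any vector l = v with an orthogonal k serves, and gives F1 (l.l) k. *)
Lemma coef_H_eq0 (y : 'rV[R]_2) b1 : dot g y y = t ->
  (forall k l v,
     fibre_curvature g y coef_a coef_b coef_d coef_a1 b1 coef_d1 k l v = 0) ->
  coef_H = 0.
Proof.
move=> yt Rm; rewrite -coef_HE.
have {}Rm k l v := etrans (esym (fibre_curvatureE gs _ _ _ _ _ _ _ k l v)) (Rm k l v).
have e0 : (delta_mx 0 0 : 'rV[R]_2) != 0.
  by apply/eqP => /rowP/(_ 0); rewrite !mxE/= => /eqP; rewrite oner_eq0.
have [y0|y0] := eqVneq y 0.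
  have [k k0 kl] := exists_orthogonal e0.
  have d0 w : dot g w 0 = 0 by rewrite /dot trmx0 mulmx0 mxE.
  have t00 : t = 0 by rewrite -yt y0 d0.
  have := Rm k (delta_mx 0 0) (delta_mx 0 0).
  rewrite y0 kl !d0 !scale0r !scaler0 subr0 !addr0 scalerA => /eqP.
  rewrite scaler_eq0 (negPf k0) orbF mulf_eq0 [X in _ || X]gt_eqF ?gpos// orbF.
  by rewrite /F1 t00 !mul0r !addr0 => /eqP ->; rewrite mulr0.
have [l l0 ly] := exists_orthogonal y0.
have tn0 : t != 0 by rewrite -yt gt_eqF// gpos.
have := Rm y l y; rewrite ly yt -/F1 -/F2 -/F3 !(mul0r, mulr0) subr0 scale0r scaler0 addr0.
have -> : F1 *: (0 - t *: l) + F3 *: (t *: (0 - t *: l)) = - ((F1 + t * F3) * t) *: l.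
  by apply/rowP => j; rewrite !mxE; ring.
move=> /eqP; rewrite scaler_eq0 (negPf l0) orbF oppr_eq0 => /eqP E.
suff -> : F1 + t * F3 = 0 by rewrite mulr0.
by apply: (mulIf tn0); rewrite mul0r.
Qed.

End FibreCurvature.

(** * Natural metrics over a coordinate domain *)

Lemma posdef_unitmx (R : realType) n (g : 'M[R]_n) :
  (forall v : 'rV[R]_n, v != 0 -> 0 < dot g v v) -> g \in unitmx.
Proof.
move=> gpos; rewrite -row_free_unit -kermx_eq0; apply/rowV0P => v /sub_kermxP vg.
by apply/eqP; apply: contraTT isT => /gpos; rewrite /dot vg mul0mx mxE ltxx.
Qed.

Lemma mder_bilinear (R : realType) (V : normedModType R) n (z v : V)
    (F : V -> 'M[R]_n) (dF : 'M[R]_n) :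
  (forall a b, fder z v (fun x => dot (F x) a b) (dot dF a b)) -> mder z v F dF.
Proof.
have E (C : 'M[R]_n) i j : C i j = dot C (delta_mx 0 i) (delta_mx 0 j).
  by rewrite /dot trmx_delta -rowE -colE !mxE.
by move=> h i j; under eq_fun do rewrite E; rewrite E.
Qed.

(** Allows a matrix to be differentiated through its action on constant row vectors, where vector
    formulas are available. *)
Lemma mder_of_rows (R : realType) (V : normedModType R) (x d : V) m p
    (F : V -> 'M[R]_(m, p)) dr :
  (forall v : 'rV_m, mder x d (fun y => v *m F y) (dr v)) ->
  exists2 dF, mder x d F dF & forall v, v *m dF = dr v.
Proof.
move=> h; have dF : mder x d F (\matrix_i dr (delta_mx 0 i)).
  move=> i j; rewrite mxE; have := h (delta_mx 0 i) 0 j; apply: near_eq_fder.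
  by apply: nearW => y; rewrite -rowE mxE.
exists (\matrix_i dr (delta_mx 0 i)) => // v; apply: mder_unique (h v).
by apply: mder_eq (mderM (mder_cst x d v) dF) _; rewrite mul0mx add0r.
Qed.

Lemma mder_row_mx (R : realType) (V : normedModType R) (z v : V) m n1 n2
    (A : V -> 'M[R]_(m, n1)) (B : V -> 'M[R]_(m, n2)) dA dB :
  mder z v A dA -> mder z v B dB ->
  mder z v (fun x => row_mx (A x) (B x)) (row_mx dA dB).
Proof.
move=> hA hB i j; case: (split_ordP j) => j' ->.
  by under eq_fun do rewrite row_mxEl; rewrite row_mxEl.
by under eq_fun do rewrite row_mxEr; rewrite row_mxEr.
Qed.

Lemma block_diag_curvature (R : pzRingType) m n (A A' dA dA' : 'M[R]_m)
    (B B' dB dB' : 'M[R]_n) :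
  block_mx dA 0 0 dB - block_mx dA' 0 0 dB'
  + (block_mx A 0 0 B *m block_mx A' 0 0 B' - block_mx A' 0 0 B' *m block_mx A 0 0 B)
  = block_mx (dA - dA' + (A *m A' - A' *m A)) 0 0 (dB - dB' + (B *m B' - B' *m B)).
Proof.
rewrite !mulmx_block !(mulmx0, mul0mx, addr0, add0r) !opp_block_mx !add_block_mx.
by rewrite !oppr0 !addr0.
Qed.

Lemma mder_comp_lsubmx (R : realType) n1 n2 m p (F : 'rV[R]_n1 -> 'M[R]_(m, p))
    (z v : 'rV[R]_(n1 + n2)) :
  (forall i j, differentiable (fun x => F x i j) (lsubmx z)) ->
  mder z v (fun w => F (lsubmx w)) (\sum_i lsubmx v 0 i *: partial_mx i F (lsubmx z)).
Proof.
move=> dF i j; apply: fder_eq (fder_comp_lsubmx v (dF i j)) _.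
by rewrite derive_partial// summxE; apply: eq_bigr => k _; rewrite [RHS]mxE; congr (_ * _); rewrite mxE.
Qed.

Lemma mder_rsubmx (R : realType) n1 n2 (z v : 'rV[R]_(n1 + n2)) :
  mder z v (fun w => rsubmx w) (rsubmx v).
Proof. by move=> i j; rewrite (ord1 i); exact: fder_coord_rsubmx. Qed.

(** Gauge transformations preserve metricity: if o is metric for [Gh], its transform C is metric for
    the metric P [Gh] P^T. *)
Lemma mder_congruence (R : realType) (V : normedModType R) (z v : V) n
    (P Gh : V -> 'M[R]_n) (dP o Q : 'M[R]_n) (C := (dP + P z *m o) *m Q) :
  mder z v P dP -> mder z v Gh (o *m Gh z + Gh z *m o^T) -> Q *m P z = 1%:M ->
  mder z v (fun w => P w *m Gh w *m (P w)^T)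
    (C *m (P z *m Gh z *m (P z)^T) + (P z *m Gh z *m (P z)^T) *m C^T).
Proof.
move=> hP hG QP; apply: mder_eq (mderM (mderM hP hG) (mderT hP)) _.
rewrite {}/C; move: (P z) (Gh z) QP => p G QP; set X := dP + p *m o.
have -> : X *m Q *m (p *m G *m p^T) = X *m G *m p^T.
  by rewrite !mulmxA -(mulmxA X) QP mulmx1.
have -> : p *m G *m p^T *m (X *m Q)^T = p *m G *m X^T.
  by rewrite trmx_mul !mulmxA -(mulmxA _ p^T) -trmx_mul QP trmx1 mulmx1.
rewrite /X [(_ + _)^T]linearD/= trmx_mul !(mulmxDl, mulmxDr) !mulmxA !addrA.
by rewrite -[LHS]addrA [X in _ + X = _]addrC !addrA.
Qed.

Section LocalMetric.
Context {R : realType} {n : nat} (U : set 'rV[R]_n) (oU : open U).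
Context (g : 'rV[R]_n -> 'M[R]_n).
Context (gC : forall k i j, Ck k U (fun x => g x i j)).
Context (gS : forall x, U x -> (g x)^T = g x).
Context (gP : forall x v, U x -> v != 0 -> 0 < dot (g x) v v).

Lemma metric_unitmx x : U x -> g x \in unitmx.
Proof. by move=> Ux; apply: posdef_unitmx => v; exact: gP. Qed.

Lemma metric_sym_near x : U x -> \forall y \near x, (g y)^T = g y.
Proof.
by move=> Ux; apply: filterS (open_nbhs_nbhs (conj oU Ux)) => y; exact: gS.
Qed.

Lemma Ck_connection k i a b : Ck k U (fun x => connection g i x a b).
Proof.
apply: (Ck_eq (f := christoffel g i a b)) => //; first by move=> x _; rewrite mxE.
apply: CkM => //; first exact: Ck_cst.
apply: Ck_sum => // l; apply: CkM => //; first exact: Ck_invmx metric_unitmx _ _ _.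
by apply: CkD => //; [apply: CkD|apply: CkN] => //; exact: Ck_partial.
Qed.

Lemma connectionP k x : U x ->
  partial_mx k g x = connection g k x *m g x + g x *m (connection g k x)^T.
Proof.
by move=> Ux; apply: metric_compat; [exact: metric_unitmx|exact: metric_sym_near].
Qed.

Lemma connectionC x i j : U x ->
  row j (connection g i x) = row i (connection g j x).
Proof.
move=> Ux; apply/rowP => k; rewrite [LHS]mxE [RHS]mxE.
by apply: connection_sym; exact: metric_sym_near.
Qed.

End LocalMetric.

(** * Covariant calculus along the projection of the tangent bundle *)

Section Lifts.
Context {R : realType} {n : nat} (U : set 'rV[R]_n) (oU : open U).
Context (g : 'rV[R]_n -> 'M[R]_n).
Context (gC : forall k i j, Ck k U (fun x => g x i j)).
Context (gS : forall x, U x -> (g x)^T = g x).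
Context (gP : forall x v, U x -> v != 0 -> 0 < dot (g x) v v).
Implicit Types (e f : 'I_(n + n)) (z : 'rV[R]_(n + n)).

(* The coordinate field [d_e] on the tangent bundle has horizontal part
   [base_part e] and vertical part [kappa e z], the image under the connection
   map. *)
Definition base_part e : 'rV[R]_n := lsubmx (delta_mx 0 e).
Definition fibre_part e : 'rV[R]_n := rsubmx (delta_mx 0 e).
Definition tube : set 'rV[R]_(n + n) := [set z | U (lsubmx z)].

Lemma open_tube : open tube.
Proof. by apply: open_comp => // x _; exact: continuous_lsubmx. Qed.

Lemma tube_near z : tube z -> \forall w \near z, tube w.
Proof. by move=> Wz; exact: open_nbhs_nbhs (conj open_tube Wz). Qed.

Definition conn_along e x : 'M[R]_n := \sum_i base_part e 0 i *: connection g i x.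

Definition kappa e z : 'rV[R]_n :=
  fibre_part e + rsubmx z *m conn_along e (lsubmx z).

Lemma mder_base_metric z e : tube z -> mder z (delta_mx 0 e) (fun w => g (lsubmx w))
  (conn_along e (lsubmx z) *m g (lsubmx z)
   + g (lsubmx z) *m (conn_along e (lsubmx z))^T).
Proof.
move=> Wz; apply: mder_eq.
  by apply: (mder_comp_lsubmx (delta_mx 0 e)) => i j; exact: Ck_differentiable (gC 1 i j) Wz.
rewrite /conn_along mulmx_suml linear_sum mulmx_sumr -big_split.
apply: eq_bigr => i _; rewrite (connectionP oU gS gP)// scalerDr.
by rewrite linearZ/= -scalemxAl -scalemxAr.
Qed.

Lemma mder_fibre_coord z e : mder z (delta_mx 0 e) (fun w => rsubmx w) (fibre_part e).
Proof. exact: mder_rsubmx. Qed.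

(** The Leibniz rule for the parallel tensor g; dv + v L, with L = [conn_along e], is the covariant
    derivative of the field v along d_e. *)
Lemma fder_dot z e (v w : 'rV[R]_(n + n) -> 'rV[R]_n) dv dw : tube z ->
  mder z (delta_mx 0 e) v dv -> mder z (delta_mx 0 e) w dw ->
  fder z (delta_mx 0 e) (fun x => dot (g (lsubmx x)) (v x) (w x))
    (dot (g (lsubmx z)) (dv + v z *m conn_along e (lsubmx z)) (w z)
     + dot (g (lsubmx z)) (v z) (dw + w z *m conn_along e (lsubmx z))).
Proof.
move=> Wz hv hw.
have := mderM (mderM hv (mder_base_metric e Wz)) (mderT hw).
move=> /(_ 0 0) /fder_eq; apply.
rewrite /dot !linearD/= trmx_mul !(mulmxDl, mulmxDr) !mulmxA.
have addE (A B : 'M[R]_1) : (A + B) 0 0 = A 0 0 + B 0 0 by rewrite mxE.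
by rewrite !addE; ring.
Qed.

Definition sqlen z : R := dot (g (lsubmx z)) (rsubmx z) (rsubmx z).

Lemma sqlen_ge0 z : tube z -> 0 <= sqlen z.
Proof.
move=> Wz; rewrite /sqlen; have [->|y0] := eqVneq (rsubmx z) 0; last exact/ltW/gP.
by rewrite /dot !mul0mx mxE.
Qed.

Lemma dotCz z v w : tube z -> dot (g (lsubmx z)) v w = dot (g (lsubmx z)) w v.
Proof. by move=> Wz; apply: dotC; exact: gS. Qed.

(** The covariant derivative along d_e of the tautological field y is [kappa e]. *)
Lemma fder_sqlen z e : tube z ->
  fder z (delta_mx 0 e) sqlen (2 * dot (g (lsubmx z)) (kappa e z) (rsubmx z)).
Proof.
move=> Wz; apply: fder_eq.
  by apply: fder_dot => //; exact: mder_fibre_coord.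
rewrite (dotCz (rsubmx z) _ Wz) -[fibre_part e + _]/(kappa e z).
by rewrite mulr_natl mulr2n.
Qed.

Lemma fder_sqlen_comp (h : R -> R) dh z e : tube z -> hder h (sqlen z) dh ->
  fder z (delta_mx 0 e) (fun w => h (sqlen w))
    (dh * (2 * dot (g (lsubmx z)) (kappa e z) (rsubmx z))).
Proof.
move=> Wz fd; apply: fder_half => //; last exact: fder_sqlen.
by apply: filterS (tube_near Wz) => w; exact: sqlen_ge0.
Qed.

Section Fibre.
Context (alpha beta alpha1 beta1 alpha2 beta2 : R -> R).
Context (da : forall t, 0 <= t -> hder alpha t (alpha1 t)).
Context (db : forall t, 0 <= t -> hder beta t (beta1 t)).
Context (da1 : forall t, 0 <= t -> hder alpha1 t (alpha2 t)).
Context (db1 : forall t, 0 <= t -> hder beta1 t (beta2 t)).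
Context (a_gt0 : forall t, 0 <= t -> 0 < alpha t).
Context (D_gt0 : forall t, 0 <= t -> 0 < alpha t + t * beta t).

Definition fibre_metric z : 'M[R]_n :=
  alpha (sqlen z) *: g (lsubmx z)
  + beta (sqlen z) *: ((g (lsubmx z) *m (rsubmx z)^T) *m (rsubmx z *m g (lsubmx z))).

Lemma dot_fibre_metric z v w : tube z -> dot (fibre_metric z) v w =
  alpha (sqlen z) * dot (g (lsubmx z)) v w
  + beta (sqlen z) * (dot (g (lsubmx z)) v (rsubmx z) * dot (g (lsubmx z)) w (rsubmx z)).
Proof.
move=> Wz; rewrite (dotCz w _ Wz) /dot /fibre_metric.
have addE (A B : 'M[R]_1) : (A + B) 0 0 = A 0 0 + B 0 0 by rewrite mxE.
have scaleE c (A : 'M[R]_1) : (c *: A) 0 0 = c * A 0 0 by rewrite mxE.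
have mulE (A B : 'M[R]_1) : A 0 0 * B 0 0 = (A *m B) 0 0 by rewrite mxE big_ord1.
by rewrite mulmxDr mulmxDl -!scalemxAr -!scalemxAl addE !scaleE mulE !mulmxA.
Qed.

Let ca t := coef_a (alpha t) (alpha1 t).
Let cb t := coef_b (alpha t) (alpha1 t) (beta t) (beta1 t) t.
Let cd t := coef_d (alpha t) (alpha1 t) (beta t) t.

Definition fibre_conn v z : 'M[R]_n :=
  fibre_connection_mx (g (lsubmx z)) (rsubmx z) (ca (sqlen z)) (cb (sqlen z))
    (cd (sqlen z)) v.

(** The part [conn_along] of A reflects that parallel transport preserves the fibre metrics; the
    part [fibre_conn] absorbs the variation of y, whose covariant derivative is [kappa e z]. The
    equations defining a, b, d make both sides agree. *)
Lemma fibre_metric_compat z e (A := conn_along e (lsubmx z) + fibre_conn (kappa e z) z) :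
  tube z -> mder z (delta_mx 0 e) fibre_metric
    (A *m fibre_metric z + fibre_metric z *m A^T).
Proof.
move=> Wz; apply: mder_bilinear => v w.
have nW := tube_near Wz.
have q0 := sqlen_ge0 Wz.
apply: (near_eq_fder (f := fun z => alpha (sqlen z) * dot (g (lsubmx z)) v w
  + beta (sqlen z) * (dot (g (lsubmx z)) v (rsubmx z) * dot (g (lsubmx z)) w (rsubmx z)))).
  by apply: filterS nW => z' Wz'; rewrite dot_fibre_metric.
have dc u : mder z (delta_mx 0 e) (fun=> u : 'rV[R]_n) 0 by exact: mder_cst.
have dy := mder_fibre_coord z e.
have h := fderD (fderM (fder_sqlen_comp e Wz (da q0)) (fder_dot Wz (dc v) (dc w)))
  (fderM (fder_sqlen_comp e Wz (db q0))
    (fderM (fder_dot Wz (dc v) dy) (fder_dot Wz (dc w) dy))).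
apply: fder_eq h _.
have E B : dot (B *m fibre_metric z + fibre_metric z *m B^T) v w =
    dot (fibre_metric z) (v *m B) w + dot (fibre_metric z) v (w *m B).
  have addE (C D : 'M[R]_1) : (C + D) 0 0 = C 0 0 + D 0 0 by rewrite mxE.
  by rewrite /dot mulmxDr mulmxDl addE trmx_mul !mulmxA.
have mulA u : u *m A = u *m conn_along e (lsubmx z) +
    fibre_connection (g (lsubmx z)) (rsubmx z) (ca (sqlen z)) (cb (sqlen z))
      (cd (sqlen z)) (kappa e z) u.
  by rewrite mulmxDr; congr (_ + _); exact: mul_fibre_connection_mx (gS Wz) _ _ _ _ _ _.
rewrite E !(dot_fibre_metric _ _ Wz) !mulA.
rewrite -[fibre_part e + _]/(kappa e z) !add0r.
have gs := gS Wz.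
rewrite -[sqlen z]/(dot (g (lsubmx z)) (rsubmx z) (rsubmx z)) in q0 *.
move: (kappa e z) (conn_along e (lsubmx z)) (rsubmx z) (g (lsubmx z)) gs q0 => k L y G gs q0.
(* From here the vectors occur only through their scalar products, which are generalised so that a
   rational identity in scalars remains. *)
have := dot_fibre_connection G y (ca (dot G y y)) (cb (dot G y y)) (cd (dot G y y)) k.
move: (fibre_connection G y _ _ _ k) => C CE.
rewrite !(dotDl, dotDr) (dotC v (C w) gs) !CE.
rewrite (dotC y v gs) (dotC y w gs) (dotC w v gs) (dotC v k gs) (dotC w k gs).
rewrite (dotC v (w *m L) gs).
move: (dot G (v *m L) y) (dot G (w *m L) y) (dot G (v *m L) w) (dot G (w *m L) v).
move: (dot G v w) (dot G v y) (dot G w y) (dot G k y) (dot G k v) (dot G k w).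
rewrite /ca /cb /cd /coef_a /coef_b /coef_d; have := a_gt0 q0; have := D_gt0 q0.
move: (dot G y y) => t.
move: (alpha t) (beta t) (alpha1 t) (beta1 t) => al be al1 be1 De0 al0 *.
by field; rewrite !gt_eqF.
Qed.


Let ca1 t := coef_a1 (alpha t) (alpha1 t) (alpha2 t).
Let cb1 t := half_deriv cb t.
Let cd1 t := coef_d1 (alpha t) (alpha1 t) (alpha2 t) (beta t) (beta1 t) t.

Lemma hder_ca t : 0 <= t -> hder ca t (ca1 t).
Proof.
move=> t0; have a0 : alpha t != 0 by rewrite gt_eqF// a_gt0.
apply: hder_eq (hder_div t0 (da1 t0) (da t0) a0) _.
by rewrite /ca1 /coef_a1 expr2.
Qed.

Lemma hder_cd t : 0 <= t -> hder cd t (cd1 t).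
Proof.
move=> t0; have D0 : alpha t + t * beta t != 0 by rewrite gt_eqF// D_gt0.
exact: hder_div t0 (hderB t0 (db t0) (da1 t0)) (hder_add_mul_id t0 (da t0) (db t0)) D0.
Qed.

(** [cb1] is left as a bare derivative: [mder_fconn] asks that it exist, and its value cancels in
    [fibre_curvatureE]. *)
Lemma hder_cb t : 0 <= t -> hder cb t (cb1 t).
Proof.
move=> t0; have a0 : alpha t != 0 by rewrite gt_eqF// a_gt0.
have D0 : alpha t + t * beta t != 0 by rewrite gt_eqF// D_gt0.
have hD := hder_add_mul_id t0 (da t0) (db t0).
have h := hderB t0 (hder_div t0 (db1 t0) hD D0)
  (hder_div t0 (hderM t0 (hderMl 2 t0 (da1 t0)) (db t0))
     (hderM t0 (da t0) hD) (mulf_neq0 a0 D0)).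
have -> : cb1 t = _ := hder_half_deriv t0 h.
exact: h.
Qed.

Definition fconn z := fibre_connection (g (lsubmx z)) (rsubmx z)
  (ca (sqlen z)) (cb (sqlen z)) (cd (sqlen z)).

Definition fconn_deriv z := fibre_connection_deriv (g (lsubmx z)) (rsubmx z)
  (ca (sqlen z)) (cb (sqlen z)) (cd (sqlen z))
  (ca1 (sqlen z)) (cb1 (sqlen z)) (cd1 (sqlen z)).

Definition fcurv z := fibre_curvature (g (lsubmx z)) (rsubmx z)
  (ca (sqlen z)) (cb (sqlen z)) (cd (sqlen z))
  (ca1 (sqlen z)) (cb1 (sqlen z)) (cd1 (sqlen z)).

Lemma mul_fibre_conn z v w : tube z -> w *m fibre_conn v z = fconn z v w.
Proof. by move=> Wz; exact: mul_fibre_connection_mx (gS Wz) _ _ _ _ _ _. Qed.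

(** [fconn] is built from g, y and functions of y.y. As g is parallel and y has covariant derivative
    [kappa e z], the covariant derivative of the field [fconn] (p, r) obeys the Leibniz rule with
    [fconn_deriv] in direction [kappa e z]; the last term converts it back to the ordinary
    derivative. *)
Lemma mder_fconn z e p r dp dr (L := conn_along e (lsubmx z)) : tube z ->
  mder z (delta_mx 0 e) p dp -> mder z (delta_mx 0 e) r dr ->
  mder z (delta_mx 0 e) (fun w => fconn w (p w) (r w))
    (fconn_deriv z (kappa e z) (p z) (r z) + fconn z (dp + p z *m L) (r z)
     + fconn z (p z) (dr + r z *m L) - fconn z (p z) (r z) *m L).
Proof.
move=> Wz hp hr; have q0 := sqlen_ge0 Wz; have dy := mder_fibre_coord z e.
have h := mderD
  (mderZ (fder_sqlen_comp e Wz (hder_ca q0))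
    (mderD (mderZ (fder_dot Wz hp dy) hr) (mderZ (fder_dot Wz hr dy) hp)))
  (mderZ (fderD (fderM (fder_sqlen_comp e Wz (hder_cb q0))
                  (fderM (fder_dot Wz hp dy) (fder_dot Wz hr dy)))
                (fderM (fder_sqlen_comp e Wz (hder_cd q0)) (fder_dot Wz hp hr))) dy).
apply: mder_eq h _.
rewrite -/L /fconn_deriv /fconn /fibre_connection /fibre_connection_deriv.
rewrite !mulmxDl -!scalemxAl mulmxDl -!scalemxAl.
rewrite -[fibre_part e + _]/(kappa e z).
have -> : kappa e z = fibre_part e + rsubmx z *m L by [].
move: (ca _) (cb _) (cd _) (ca1 _) (cb1 _) (cd1 _) => a b d a1 b1 d1.
move: (p z) (r z) (rsubmx z) (g (lsubmx z)) (fibre_part e) => P1 R1 y G w.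
rewrite !(dotDl, dotDr).
move: (P1 *m L) (R1 *m L) (y *m L) => PL RL yL.
apply/rowP => j; rewrite !mxE; ring.
Qed.


(** * Connection and curvature of the natural metric over a flat base *)

Context (gflat : forall x i j, U x -> curvature_mx g i j x = 0).

Lemma differentiable_connection z i a b : tube z ->
  differentiable (fun x => connection g i x a b) (lsubmx z).
Proof.
by move=> Wz; exact: Ck_differentiable (Ck_connection oU gC gP 1 i a b) Wz.
Qed.

Definition conn_along_deriv e f z : 'M[R]_n :=
  \sum_i \sum_j (base_part e 0 i * base_part f 0 j) *:
     partial_mx i (connection g j) (lsubmx z).

Lemma mder_conn_along z e f : tube z ->
  mder z (delta_mx 0 e) (fun w => conn_along f (lsubmx w)) (conn_along_deriv e f z).
Proof.
move=> Wz; rewrite /conn_along /conn_along_deriv exchange_big.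
apply: mder_sum => j _.
have h := mder_comp_lsubmx (delta_mx 0 e) (fun a b => differentiable_connection j a b Wz).
apply: mder_eq (mderZ (fder_cst z (delta_mx 0 e) (base_part f 0 j)) h) _.
rewrite scale0r add0r scaler_sumr; apply: eq_bigr => i _.
by rewrite scalerA mulrC.
Qed.

(* This is where the flatness of the base metric enters. *)
Lemma conn_along_flat z e f (L := fun a => conn_along a (lsubmx z)) : tube z ->
  conn_along_deriv e f z + L f *m L e = conn_along_deriv f e z + L e *m L f.
Proof.
move=> Wz; rewrite /L /conn_along /conn_along_deriv.
have mulE (a b : 'I_(n + n)) :
    (\sum_i base_part a 0 i *: connection g i (lsubmx z)) *m
    (\sum_i base_part b 0 i *: connection g i (lsubmx z)) =
    \sum_i \sum_j (base_part b 0 i * base_part a 0 j) *: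
       (connection g j (lsubmx z) *m connection g i (lsubmx z)).
  rewrite mulmx_sumr; apply: eq_bigr => i _; rewrite mulmx_suml.
  by apply: eq_bigr => j _; rewrite -scalemxAl -scalemxAr scalerA mulrC.
rewrite !mulE -!big_split/= [RHS](eq_bigr _ (fun i _ => esym (big_split _ _ _ _ _)))/=.
rewrite [LHS](eq_bigr _ (fun i _ => esym (big_split _ _ _ _ _)))/= [RHS]exchange_big/=.
apply: eq_bigr => i _; apply: eq_bigr => j _.
have flat_ij : partial_mx i (connection g j) (lsubmx z)
    + connection g j (lsubmx z) *m connection g i (lsubmx z)
  = partial_mx j (connection g i) (lsubmx z)
    + connection g i (lsubmx z) *m connection g j (lsubmx z).
  by apply/eqP; rewrite -subr_eq0 opprD addrACA; apply/eqP; exact: gflat.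
move: (partial_mx i _ _) (partial_mx j _ _) (_ *m _) (_ *m _) flat_ij => a b c d E.
by rewrite -!scalerDr E mulrC.
Qed.

Definition kappa_deriv e f z : 'rV[R]_n :=
  fibre_part e *m conn_along f (lsubmx z) + rsubmx z *m conn_along_deriv e f z.

Lemma mder_kappa z e f : tube z ->
  mder z (delta_mx 0 e) (kappa f) (kappa_deriv e f z).
Proof.
move=> Wz; apply: mder_eq (mderD (mder_cst z (delta_mx 0 e) (fibre_part f))
  (mderM (mder_fibre_coord z e) (mder_conn_along e f Wz))) _.
by rewrite add0r.
Qed.

Definition nabla_kappa e f z : 'rV[R]_n :=
  kappa_deriv e f z + kappa f z *m conn_along e (lsubmx z).

(** [nabla_kappa e f] is the second covariant derivative of the tautological field y along d_f and
    then d_e; over a flat base these commute. *)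
Lemma nabla_kappaC e f z : tube z -> nabla_kappa e f z = nabla_kappa f e z.
Proof.
move=> Wz; rewrite /nabla_kappa /kappa_deriv /kappa !mulmxDl -!mulmxA.
rewrite addrACA -mulmxDr (conn_along_flat e f Wz) mulmxDr.
by rewrite [X in X + _ = _]addrC addrACA.
Qed.

Lemma fconnDr z v w w' : fconn z v (w + w') = fconn z v w + fconn z v w'.
Proof.
rewrite /fconn /fibre_connection !(dotDl, dotDr); apply/rowP => j; rewrite !mxE.
by move: (dot _ _ _) (dot _ _ _) (dot _ _ _) (dot _ _ _) (dot _ _ _) => *; ring.
Qed.

Lemma fconnC z v w : tube z -> fconn z v w = fconn z w v.
Proof. by move=> Wz; apply: fibre_connectionC; exact: gS. Qed.

Definition omegaV e z : 'M[R]_n := conn_along e (lsubmx z) + fibre_conn (kappa e z) z.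

Lemma mul_omegaV e z v : tube z ->
  v *m omegaV e z = v *m conn_along e (lsubmx z) + fconn z (kappa e z) v.
Proof. by move=> Wz; rewrite mulmxDr; congr (_ + _); exact: mul_fibre_conn. Qed.

Lemma mder_omegaV z e f : tube z -> exists2 dA, mder z (delta_mx 0 e) (omegaV f) dA &
  forall v, v *m dA = v *m conn_along_deriv e f z
    + (fconn_deriv z (kappa e z) (kappa f z) v + fconn z (nabla_kappa e f z) v
       + fconn z (kappa f z) (v *m conn_along e (lsubmx z))
       - fconn z (kappa f z) v *m conn_along e (lsubmx z)).
Proof.
move=> Wz; apply: mder_of_rows => v.
apply: (near_eq_mder (F := fun w => v *m conn_along f (lsubmx w)
    + fconn w (kappa f w) v)).
  by apply: filterS (tube_near Wz) => w Ww; rewrite mul_omegaV.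
apply: mderD.
  apply: mder_eq (mderM (mder_cst z (delta_mx 0 e) v) (mder_conn_along e f Wz)) _.
  by rewrite mul0mx add0r.
apply: mder_eq (mder_fconn Wz (mder_kappa e f Wz) (mder_cst z (delta_mx 0 e) v)) _.
by rewrite add0r.
Qed.

Lemma mder_omegaV_partial z e f v : tube z -> v *m partial_mx e (omegaV f) z =
  v *m conn_along_deriv e f z
    + (fconn_deriv z (kappa e z) (kappa f z) v + fconn z (nabla_kappa e f z) v
       + fconn z (kappa f z) (v *m conn_along e (lsubmx z))
       - fconn z (kappa f z) v *m conn_along e (lsubmx z)).
Proof.
by move=> Wz; have [dA hA <-] := mder_omegaV e f Wz; rewrite (partial_mxE hA).
Qed.

(** Of the two ingredients of [omegaV], [conn_along] is flat and [fconn] is differentiated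
    covariantly, so what survives antisymmetrisation is the curvature of the fibre in the directions
    [kappa e] and [kappa f]. *)
Lemma omegaV_curvature z e f v : tube z ->
  v *m (partial_mx e (omegaV f) z - partial_mx f (omegaV e) z
        + (omegaV f z *m omegaV e z - omegaV e z *m omegaV f z))
  = fcurv z (kappa e z) (kappa f z) v.
Proof.
(* Arranged so that every summand other than [fconn_deriv] and the iterated [fconn] is symmetric in
   a and b: the first by [conn_along_flat], the third by [nabla_kappaC], the bracketed pair
   visibly. *)
move=> Wz; have half a b : v *m partial_mx a (omegaV b) z + v *m omegaV b z *m omegaV a z =
  v *m (conn_along_deriv a b z + conn_along b (lsubmx z) *m conn_along a (lsubmx z))
  + fconn_deriv z (kappa a z) (kappa b z) v + fconn z (nabla_kappa a b z) v
  + (fconn z (kappa b z) (v *m conn_along a (lsubmx z))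
     + fconn z (kappa a z) (v *m conn_along b (lsubmx z)))
  + fconn z (kappa a z) (fconn z (kappa b z) v).
  rewrite (mder_omegaV_partial _ _ _ Wz) !(mul_omegaV _ _ Wz) fconnDr mulmxDl mulmxDr mulmxA.
  move: (_ *m conn_along_deriv _ _ _) (_ *m _ *m _) (fconn_deriv _ _ _ _).
  move: (fconn _ _ _ *m _) (fconn _ (nabla_kappa _ _ _) _) (fconn _ _ (fconn _ _ _)).
  move: (fconn _ _ (_ *m _)) (fconn _ _ (_ *m _)) => a1 a2 a3 a4 a5 a6 a7 a8.
  by apply/rowP => j; rewrite !mxE; ring.
have dist (X Y A B : 'M[R]_n) : v *m (X - Y + (A *m B - B *m A)) =
    (v *m X + v *m A *m B) - (v *m Y + v *m B *m A).
  by rewrite mulmxDr !mulmxBr !mulmxA addrACA opprD.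
apply: (etrans (dist _ _ _ _)).
apply: (etrans (congr2 (fun a b => a - b) (half e f) (half f e))).
rewrite (conn_along_flat e f Wz) (nabla_kappaC e f Wz).
rewrite [X in _ - (_ + X + _)]addrC.
rewrite /fcurv /fibre_curvature -/(fconn_deriv z) -/(fconn z).
move: (v *m _) (fconn _ (nabla_kappa _ _ _) _) (_ + fconn _ _ (_ *m _)).
move: (fconn_deriv _ _ _ _) (fconn_deriv _ _ _ _) (fconn _ _ (fconn _ _ _)).
move: (fconn _ _ (fconn _ _ _)) => a1 a2 a3 a4 a5 a6 a7.
by apply/rowP => j; rewrite !mxE; ring.
Qed.

(* Row [e] of [adapt_mx z] is [(pi_* d_e, K d_e)]. *)
Definition hor_mx z : 'M[R]_n := \matrix_(i < n) (rsubmx z *m connection g i (lsubmx z)).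
Definition adapt_mx z : 'M[R]_(n + n) := block_mx 1%:M (hor_mx z) 0 1%:M.
Definition adapt_inv z : 'M[R]_(n + n) := block_mx 1%:M (- hor_mx z) 0 1%:M.

Lemma adapt_mxK z : adapt_mx z *m adapt_inv z = 1%:M.
Proof.
rewrite /adapt_mx /adapt_inv mulmx_block !(mulmx0, mul0mx, mulmx1, mul1mx).
by rewrite !(addr0, add0r) addNr -scalar_mx_block.
Qed.

Lemma base_mul_hor z e :
  base_part e *m hor_mx z = rsubmx z *m conn_along e (lsubmx z).
Proof.
rewrite mulmx_sum_row /conn_along mulmx_sumr; apply: eq_bigr => i _.
by rewrite rowK scalemxAr.
Qed.

Lemma row_adapt e z : delta_mx 0 e *m adapt_mx z = row_mx (base_part e) (kappa e z).
Proof.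
rewrite -[delta_mx 0 e]hsubmxK /adapt_mx mul_row_block -/(base_part e) -/(fibre_part e).
by rewrite !mulmx1 mulmx0 addr0 base_mul_hor addrC.
Qed.

Lemma Ck_hor_mx k i j : Ck k tube (fun z => hor_mx z i j).
Proof.
apply: (Ck_eq (f := fun z => \sum_l rsubmx z 0 l * connection g i (lsubmx z) l j)).
- exact: open_tube.
- by move=> z _; rewrite mxE [RHS]mxE.
- apply: Ck_sum => [|l]; first exact: open_tube.
  apply: CkM; [exact: open_tube|exact/Ck_coord_rsubmx/open_tube|].
  apply: (Ck_comp_lsubmx oU (f := fun x => connection g i x l j)).
  exact: Ck_connection.
Qed.

Lemma Ck_adapt k i j : Ck k tube (fun z => adapt_mx z i j).
Proof.
rewrite /adapt_mx; case: (split_ordP i) => i' ->; case: (split_ordP j) => j' ->.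
- by under eq_fun do rewrite block_mxEul; apply: Ck_cst; exact: open_tube.
- by under eq_fun do rewrite block_mxEur; exact: Ck_hor_mx.
- by under eq_fun do rewrite block_mxEdl; apply: Ck_cst; exact: open_tube.
- by under eq_fun do rewrite block_mxEdr; apply: Ck_cst; exact: open_tube.
Qed.

Lemma differentiable_adapt_inv i j z : tube z ->
  differentiable (fun z => adapt_inv z i j) z.
Proof.
move=> Wz; have : Ck 1 tube (fun z => adapt_inv z i j); last by case=> + _; exact.
rewrite /adapt_inv; case: (split_ordP i) => i' ->; case: (split_ordP j) => j' ->.
- by under eq_fun do rewrite block_mxEul; apply: Ck_cst; exact: open_tube.
- under eq_fun do rewrite block_mxEur mxE.
  by apply: CkN; [exact: open_tube|exact: Ck_hor_mx].
- by under eq_fun do rewrite block_mxEdl; apply: Ck_cst; exact: open_tube.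
- by under eq_fun do rewrite block_mxEdr; apply: Ck_cst; exact: open_tube.
Qed.

Lemma mder_adapt z e : tube z ->
  mder z (delta_mx 0 e) adapt_mx (partial_mx e adapt_mx z).
Proof.
by move=> Wz; apply: mder_partial => i j; have [+ _] := Ck_adapt 1 i j; exact.
Qed.

Lemma row_partial_adapt z e f : tube z ->
  delta_mx 0 f *m partial_mx e adapt_mx z = row_mx 0 (kappa_deriv e f z).
Proof.
move=> Wz; have h := mderM (mder_cst z (delta_mx 0 e) (delta_mx 0 f : 'rV_(n + n))) (mder_adapt e Wz).
have h' := mder_row_mx (mder_cst z (delta_mx 0 e) (base_part f)) (mder_kappa e f Wz).
have E : {near z, (fun w => row_mx (base_part f) (kappa f w)) =1
                  (fun w => delta_mx 0 f *m adapt_mx w)}.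
  by apply: filterS (tube_near Wz) => w _; rewrite row_adapt.
have := mder_unique h (near_eq_mder E h').
by rewrite mul0mx add0r.
Qed.

Definition omega e z : 'M[R]_(n + n) :=
  block_mx (conn_along e (lsubmx z)) 0 0 (omegaV e z).

(** Row f is the covariant derivative of d_f along d_e for the candidate connection, with components
    in the adapted frame. *)
Definition lift_frame e z : 'M[R]_(n + n) :=
  partial_mx e adapt_mx z + adapt_mx z *m omega e z.

Lemma row_lift_frame z e f : tube z -> delta_mx 0 f *m lift_frame e z =
  row_mx (base_part f *m conn_along e (lsubmx z))
         (nabla_kappa e f z + fconn z (kappa e z) (kappa f z)).
Proof.
move=> Wz; rewrite mulmxDr row_partial_adapt// mulmxA row_adapt mul_row_block.
rewrite !mulmx0 addr0 add0r add_row_mx add0r (mul_omegaV _ _ Wz) addrA.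
by [].
Qed.

(** The candidate connection is torsion-free: horizontally by the symmetry of the Christoffel
    symbols of g, vertically by that of [fconn] and of [nabla_kappa]. The last one uses flatness of
    g, which is why a block diagonal connection is possible. *)
Lemma lift_frameC z e f : tube z ->
  (delta_mx 0 f : 'rV_(n + n)) *m lift_frame e z
  = (delta_mx 0 e : 'rV_(n + n)) *m lift_frame f z.
Proof.
move=> Wz; rewrite (row_lift_frame e f Wz) (row_lift_frame f e Wz).
rewrite (nabla_kappaC e f Wz) (fconnC (kappa e z) _ Wz).
suff -> : base_part f *m conn_along e (lsubmx z) =
          base_part e *m conn_along f (lsubmx z) by [].
rewrite !mulmx_sum_row /conn_along.
have E a b : \sum_i base_part a 0 i *: row i (\sum_j base_part b 0 j *: connection g j (lsubmx z))
  = \sum_i \sum_j (base_part a 0 i * base_part b 0 j) *: row i (connection g j (lsubmx z)).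
  apply: eq_bigr => i _; rewrite linear_sum scaler_sumr; apply: eq_bigr => j _.
  by rewrite linearZ scalerA.
rewrite !E exchange_big; apply: eq_bigr => i _; apply: eq_bigr => j _.
by rewrite (connectionC oU gS) // mulrC.
Qed.

Definition nat_metric z : 'M[R]_(n + n) :=
  adapt_mx z *m block_mx (g (lsubmx z)) 0 0 (fibre_metric z) *m (adapt_mx z)^T.

(** The candidate connection is metric: each diagonal block of [omega] is metric for the
    corresponding block of G, and [mder_congruence] transports this out of the frame. *)
Lemma mder_nat_metric z e : tube z ->
  mder z (delta_mx 0 e) nat_metric
    (lift_frame e z *m adapt_inv z *m nat_metric z
     + nat_metric z *m (lift_frame e z *m adapt_inv z)^T).
Proof.
move=> Wz; have hG := mder_block (mder_base_metric e Wz) (mder_cst z (delta_mx 0 e) 0)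
  (mder_cst z (delta_mx 0 e) 0) (fibre_metric_compat e Wz).
have QP : adapt_inv z *m adapt_mx z = 1%:M by apply: mulmx1C; exact: adapt_mxK.
apply: mder_congruence (mder_adapt e Wz) _ QP; apply: mder_eq hG _.
rewrite /omega tr_block_mx !trmx0 !mulmx_block add_block_mx.
by rewrite !(mulmx0, mul0mx, addr0, add0r).
Qed.

Context (Gm : 'rV[R]_(n + n) -> 'M[R]_(n + n)).
Context (GmE : forall z, tube z -> Gm z = nat_metric z).
Context (GmP : forall z v, tube z -> v != 0 -> 0 < dot (Gm z) v v).

Lemma trmx_nat_metric z : tube z -> (nat_metric z)^T = nat_metric z.
Proof.
move=> Wz; rewrite /nat_metric !trmx_mul trmxK tr_block_mx !trmx0 (gS Wz) mulmxA.
congr (_ *m block_mx _ _ _ _ *m _).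
by rewrite /fibre_metric linearD/= !linearZ/= !trmx_mul trmxK (gS Wz).
Qed.

(* Uniqueness of the Levi-Civita connection, applied to the connection that is
   [omega] in the frame [adapt_mx]. *)
Lemma nat_connection z e : tube z ->
  connection Gm e z *m adapt_mx z = lift_frame e z.
Proof.
move=> Wz; have nW := tube_near Wz.
suff -> : connection Gm e z = lift_frame e z *m adapt_inv z.
  by rewrite -mulmxA (mulmx1C (adapt_mxK z)) mulmx1.
have symG : \forall w \near z, (Gm w)^T = Gm w.
  by apply: filterS nW => w Ww; rewrite GmE// trmx_nat_metric.
have unitG : Gm z \in unitmx by apply: posdef_unitmx => v; exact: GmP.
apply: (koszul (C := fun a => lift_frame a z *m adapt_inv z) unitG symG) => [a b c|a].
  have rowE (A : 'M[R]_(n + n)) i j :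
      A i j = ((delta_mx 0 i : 'rV_(n + n)) *m A) 0 j.
    by rewrite -rowE mxE.
  by rewrite [LHS]rowE [RHS]rowE !mulmxA (lift_frameC a b Wz).
have E : {near z, nat_metric =1 Gm} by apply: filterS nW => w Ww; rewrite GmE.
by rewrite (partial_mxE (near_eq_mder E (mder_nat_metric a Wz))) -GmE.
Qed.

(** In the frame the curvature of a block diagonal connection is block diagonal, and its horizontal
    block is the vanishing curvature of g. *)
Lemma nat_curvature z e f : tube z -> curvature_mx Gm e f z *m adapt_mx z =
  adapt_mx z *m block_mx 0 0 0 (partial_mx e (omegaV f) z - partial_mx f (omegaV e) z
        + (omegaV f z *m omegaV e z - omegaV e z *m omegaV f z)).
Proof.
move=> Wz; have dL a b : mder z (delta_mx 0 a) (omega b)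
   (block_mx (conn_along_deriv a b z) 0 0 (partial_mx a (omegaV b) z)).
  apply: mder_block; [exact: mder_conn_along|exact: mder_cst|exact: mder_cst|].
  by have [dA hA _] := mder_omegaV a b Wz; rewrite (partial_mxE hA).
have dom a i j w : tube w -> differentiable (fun y => omega a y i j) w.
  move=> Ww; have [dA hA _] := mder_omegaV a a Ww.
  by have [] := mder_block (mder_conn_along a a Ww) (mder_cst w (delta_mx 0 a) 0)
    (mder_cst w (delta_mx 0 a) 0) hA i j.
have gauge a w : tube w -> connection Gm a w *m adapt_mx w =
    partial_mx a adapt_mx w + adapt_mx w *m omega a w by exact: nat_connection.
have PQ w : tube w -> adapt_mx w *m adapt_inv w = 1%:M by move=> _; exact: adapt_mxK.
have := gauge_curvature open_tube PQ (Ck_adapt 2) differentiable_adapt_inv dom gauge e f Wz.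
move=> ->; congr (_ *m _).
rewrite (partial_mxE (dL e f)) (partial_mxE (dL f e)) block_diag_curvature.
suff -> : conn_along_deriv e f z - conn_along_deriv f e z
  + (conn_along f (lsubmx z) *m conn_along e (lsubmx z)
     - conn_along e (lsubmx z) *m conn_along f (lsubmx z)) = 0 by [].
by rewrite addrACA -opprD (conn_along_flat e f Wz) subrr.
Qed.

Lemma nat_curvature_eq0 z : tube z ->
  (forall e f, curvature_mx Gm e f z = 0) <->
  (forall e f v, fcurv z (kappa e z) (kappa f z) v = 0).
Proof.
move=> Wz; split=> [K0 e f v|R0 e f].
  rewrite -(omegaV_curvature e f v Wz); set B := (X in v *m X).
  suff -> : B = 0 by rewrite mulmx0.
  have := nat_curvature e f Wz; rewrite K0 mul0mx -/B => /esym/(congr1 (mulmx (adapt_inv z))).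
  rewrite mulmxA (mulmx1C (adapt_mxK z)) mul1mx mulmx0 => E.
  apply/matrixP => i j; have /matrixP/(_ (rshift n i) (rshift n j)) := E.
  by rewrite block_mxEdr => ->; rewrite [LHS]mxE [RHS]mxE.
have := nat_curvature e f Wz; set B := (X in block_mx _ _ _ X) => E.
have B0 : B = 0 by apply/row_matrixP => i; rewrite rowE omegaV_curvature// R0 row0.
have {}E : curvature_mx Gm e f z *m adapt_mx z = 0.
  by rewrite E B0 block_mx0 mulmx0.
by rewrite -[LHS]mulmx1 -(adapt_mxK z) mulmxA E mul0mx.
Qed.

(** * The zero section and flatness of the base *)

Lemma hor_mx_zero_section x : hor_mx (row_mx x 0) = 0.
Proof. by apply/row_matrixP => i; rewrite rowK row_mxKr mul0mx row0. Qed.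

Lemma nat_metric_block z (S := hor_mx z) (h := fibre_metric z) :
  nat_metric z =
  block_mx (g (lsubmx z) + S *m h *m S^T) (S *m h) (h *m S^T) h.
Proof.
rewrite /nat_metric tr_block_mx !trmx1 trmx0 !mulmx_block.
by rewrite !(mulmx0, mul0mx, mulmx1, mul1mx, addr0, add0r).
Qed.

Lemma nat_metric_zero_section x : nat_metric (row_mx x 0) =
  block_mx (g x) 0 0 (alpha 0 *: g x).
Proof.
rewrite nat_metric_block hor_mx_zero_section !mul0mx trmx0 mulmx0 addr0 row_mxKl.
congr block_mx; rewrite /fibre_metric /sqlen !row_mxKl !row_mxKr.
by rewrite trmx0 !mulmx0 mul0mx scaler0 addr0 /dot !mul0mx mxE.
Qed.

Lemma tube_zero_section x : U x -> tube (row_mx x 0).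
Proof. by rewrite /tube /= row_mxKl. Qed.

Lemma base_near x : U x -> \forall y \near x, U y.
Proof. by move=> Ux; exact: open_nbhs_nbhs (conj oU Ux). Qed.

Lemma partial_nat_base x i a b : U x ->
  partial (lshift n i) (fun z => Gm z a b) (row_mx x 0) =
  partial i (fun x => block_mx (g x) 0 0 (alpha 0 *: g x) a b) x.
Proof.
move=> Ux; rewrite partial_zero_section; apply: near_eq_derive.
apply: filterS (base_near Ux) => y Uy.
by rewrite (GmE (tube_zero_section Uy)) nat_metric_zero_section.
Qed.

(** The horizontal coordinate block of G is g + S h S^T, with S = [hor_mx] linear in y: its
    dependence on y is of second order at the zero section. *)
Lemma partial_nat_fibre x k i j : U x ->
  partial (rshift n k) (fun z => Gm z (lshift n i) (lshift n j)) (row_mx x 0) = 0.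
Proof.
move=> Ux; have Wz := tube_zero_section Ux; set z := row_mx x 0 in Wz *.
set e := rshift n k.
have dS : mder z (delta_mx 0 e) hor_mx (partial_mx e hor_mx z).
  by apply: mder_partial => a b; have [+ _] := Ck_hor_mx 1 a b; exact.
have dh := fibre_metric_compat e Wz.
have h := mderD (mder_base_metric e Wz) (mderM (mderM dS dh) (mderT dS)).
have E : {near z, (fun w => g (lsubmx w) + hor_mx w *m fibre_metric w *m (hor_mx w)^T)
  =1 (fun w => ulsubmx (Gm w))}.
  apply: filterS (tube_near Wz) => w Ww.
  by rewrite (GmE Ww) nat_metric_block block_mxKul.
have := near_eq_mder E h i j.
have S0 : hor_mx z = 0 by exact: hor_mx_zero_section.
have L0 : conn_along e (lsubmx z) = 0.
  rewrite /conn_along big1// => l _.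
  by rewrite /base_part /e lsubmx_delta_rshift mxE scale0r.
rewrite L0 S0 !(mul0mx, trmx0, mulmx0, addr0) mxE.
suff -> : (fun w => ulsubmx (Gm w) i j) = (fun w => Gm w (lshift n i) (lshift n j)).
  by move=> /fderE.
by apply/funext => w; rewrite [LHS]mxE [LHS]mxE.
Qed.

Lemma nat_metric_unitmx z : tube z -> Gm z \in unitmx.
Proof. by move=> Wz; apply: posdef_unitmx => v; exact: GmP. Qed.

Lemma nat_metric_sym_near z : tube z -> \forall w \near z, (Gm w)^T = Gm w.
Proof.
by move=> Wz; apply: filterS (tube_near Wz) => w Ww; rewrite (GmE Ww) trmx_nat_metric.
Qed.

(** The zero section is totally geodesic and carries the connection of g. In the lowered symbols
    with a vertical last index, the mixed blocks vanish along the zero section and the remaining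
    derivative is zero by [partial_nat_fibre]. *)
Lemma nat_connection_zero_section x i j : U x ->
  row (lshift n j) (connection Gm (lshift n i) (row_mx x 0)) =
  row_mx (row j (connection g i x)) 0.
Proof.
move=> Ux; have Wz := tube_zero_section Ux; set z := row_mx x 0 in Wz *.
have uG := nat_metric_unitmx Wz; have sG := nat_metric_sym_near Wz.
apply: (can_inj (mulmxK uG)); rewrite -row_mul.
rewrite {2}(GmE Wz) nat_metric_zero_section mul_row_block !mulmx0 mul0mx !addr0 -row_mul.
have ug := metric_unitmx gP Ux; have sg := metric_sym_near oU gS Ux.
have ulE a c : (fun y => block_mx (g y) 0 0 (alpha 0 *: g y) (lshift n a) (lshift n c))
    = (fun y => g y a c) by apply/funext => y; rewrite block_mxEul.
have urE a c : (fun y => block_mx (g y) 0 0 (alpha 0 *: g y) (lshift n a) (rshift n c))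
    = (fun=> 0 : R) by apply/funext => y; rewrite block_mxEur mxE.
apply/rowP => b; rewrite [LHS]mxE (connection_lower uG sG).
case: (split_ordP b) => k ->.
  rewrite row_mxEl [RHS]mxE (connection_lower ug sg) !(partial_nat_base _ _ _ Ux).
  by rewrite !ulE.
rewrite row_mxEr [RHS]mxE (partial_nat_fibre _ _ _ Ux) !(partial_nat_base _ _ _ Ux).
by rewrite !urE /partial !derive_cst subr0 addr0 mulr0.
Qed.

(** For horizontal indices the curvature formula takes derivatives along the zero section only, and
    the sums over an intermediate index lose their vertical part by [connE0]; what is left is the
    curvature of g. *)
Lemma flat_base_of_flat x : U x ->
  (forall e f, curvature_mx Gm e f (row_mx x 0) = 0) -> forall i j, curvature_mx g i j x = 0.
Proof.
move=> Ux K0 i j; have Wz := tube_zero_section Ux.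
have connE y a b c : U y ->
    connection Gm (lshift n a) (row_mx y 0) (lshift n b) (lshift n c)
    = connection g a y b c.
  move=> Uy; have /rowP/(_ (lshift n c)) := nat_connection_zero_section a b Uy.
  by rewrite row_mxEl mxE => ->; rewrite mxE.
have connE0 a b c : connection Gm (lshift n a) (row_mx x 0) (lshift n b) (rshift n c) = 0.
  have /rowP/(_ (rshift n c)) := nat_connection_zero_section a b Ux.
  by rewrite row_mxEr mxE => ->; rewrite mxE.
have pE a b k l :
    partial_mx (lshift n a) (connection Gm (lshift n b)) (row_mx x 0) (lshift n k) (lshift n l)
    = partial_mx a (connection g b) x k l.
  rewrite [LHS]mxE [RHS]mxE partial_zero_section; apply: near_eq_derive.
  by apply: filterS (base_near Ux) => y Uy; exact: connE.
have mE a b k l : (connection Gm (lshift n a) (row_mx x 0) *m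
    connection Gm (lshift n b) (row_mx x 0)) (lshift n k) (lshift n l)
    = (connection g a x *m connection g b x) k l.
  rewrite [LHS]mxE [RHS]mxE big_split_ord/= [X in _ + X]big1 ?addr0; last first.
    by move=> m _; rewrite connE0 mul0r.
  by apply: eq_bigr => m _; rewrite !connE.
have entryE p (A B C D : 'M[R]_p) a b :
    (A - B + (C - D)) a b = A a b - B a b + (C a b - D a b) by rewrite !mxE.
apply/matrixP => k l; rewrite [RHS]mxE.
have K : curvature_mx Gm (lshift n i) (lshift n j) (row_mx x 0) (lshift n k) (lshift n l) = 0.
  by rewrite K0 mxE.
apply: etrans (entryE _ _ _ _ _ _ _) _.
apply: etrans (etrans (esym (entryE _ _ _ _ _ _ _)) K).
apply: (congr2 (fun u v : R => u + v)); apply: (congr2 (fun u v : R => u - v)); apply: esym.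
- exact: pE.
- exact: pE.
- exact: mE.
- exact: mE.
Qed.

End Fibre.

End Lifts.

(** * Tangent vectors in charts *)

Lemma near_eq_diff (R : realType) (V W : normedModType R) (f g : V -> W) z :
  {near z, f =1 g} -> differentiable f z -> 'd g z = 'd f z :> (V -> W).
Proof.
move=> fg df; have dg := near_eq_differentiable fg df.
apply/funext => v; rewrite -!deriveE//; apply: near_eq_derive.
by apply: filterS fg => x ->.
Qed.

Section Representatives.
Context {R : realType} {X Y : Type} {n m : nat} (A : atlas R X n) (B : atlas R Y m).
Context (inj : forall (a : chart A) p q, dom a p -> dom a q -> crd a p = crd a q -> p = q).

Lemma local_repE (f : X -> Y) (a : chart A) (b : chart B) p :
  dom a p -> dom b (f p) -> local_rep f a b (crd a p) = crd b (f p).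
Proof.
move=> ap bp; rewrite /local_rep; case: xgetP => [y _ [q [aq bq qp <-]]|H].
  by rewrite (inj aq ap qp).
by case: (H (crd b (f p))); exists p.
Qed.

End Representatives.

(* What is needed of an atlas to handle tangent vectors in charts; it holds for
   the atlas of a manifold and for the induced atlas of its tangent bundle. *)
Record tame_atlas (R : realType) (X : Type) n (A : atlas R X n) : Prop := TameAtlas {
  tame_inj : forall (a : chart A) p q, dom a p -> dom a q -> crd a p = crd a q -> p = q;
  tame_open : forall a b : chart A, open (local_dom idfun a b);
  tame_diff : forall (a b : chart A) x, local_dom idfun a b x ->
    differentiable (transition a b) x }.

Section TameAtlas.
Context {R : realType} {X : Type} {n : nat} (A : atlas R X n) (tA : tame_atlas A).
Implicit Types (a b c : chart A).

Lemma transitionE a b p : dom a p -> dom b p -> transition a b (crd a p) = crd b p.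
Proof. exact: local_repE (tame_inj tA) idfun a b p. Qed.

Lemma crd_local_dom a b p : dom a p -> dom b p -> local_dom idfun a b (crd a p).
Proof. by move=> ap bp; exists p. Qed.

Lemma near_local_dom a b p : dom a p -> dom b p ->
  \forall x \near crd a p, local_dom idfun a b x.
Proof.
move=> ap bp; apply: open_nbhs_nbhs; split; first exact: tame_open.
exact: crd_local_dom.
Qed.

Lemma diff_transition_id a p v : dom a p -> 'd (transition a a) (crd a p) v = v.
Proof.
move=> ap; have E : {near crd a p, id =1 transition a a}.
  by apply: filterS (near_local_dom ap ap) => _ [q [aq _] <-]; rewrite transitionE.
by rewrite (near_eq_diff E (@ex_diff _ _ _ _ _ _ _ (is_diff_id _))) diff_val.
Qed.

Lemma diff_transition_comp a b c p v : dom a p -> dom b p -> dom c p ->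
  'd (transition b c) (crd b p) ('d (transition a b) (crd a p) v) =
  'd (transition a c) (crd a p) v.
Proof.
move=> ap bp cp; have dab := tame_diff tA (crd_local_dom ap bp).
have dbc := tame_diff tA (crd_local_dom bp cp).
have E : {near crd a p, transition b c \o transition a b =1 transition a c}.
  apply: filterS2 (near_local_dom ap bp) (near_local_dom ap cp).
  move=> _ [q [aq bq] <-] [q' [aq' cq'] qq'] /=; have {}aq' := tame_inj tA aq' aq qq'.
  by rewrite aq' in cq'; rewrite !transitionE.
rewrite -(transitionE ap bp) in dbc.
have e1 := congr1 (fun h => h v) (near_eq_diff E (differentiable_comp dab dbc)).
have e2 := congr1 (fun h => h v) (diff_comp dab dbc).
by rewrite -(transitionE ap bp); exact: esym (etrans e1 e2).
Qed.

Lemma tangent_cpt p (v : tangent A p) a b : dom a p -> dom b p ->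
  cpt v b = 'd (transition a b) (crd a p) (cpt v a).
Proof. by move=> ap bp; have /asboolP[_ vE] := valP v; exact: vE. Qed.

Lemma cpt_inj p (u v : tangent A p) a : dom a p -> cpt u a = cpt v a -> u = v.
Proof.
move=> ap uv; apply/val_inj/funext => b; rewrite -!/(cpt _ b).
case: (pselect (dom b p)) => bp; first by rewrite !(tangent_cpt _ ap bp) uv.
have /asboolP[u0 _] := valP u; have /asboolP[v0 _] := valP v.
by rewrite /cpt u0// v0.
Qed.

Lemma exists_tangent p a (v : 'rV[R]_n) : dom a p ->
  exists u : tangent A p, cpt u a = v.
Proof.
move=> ap; have [w [wE w0]] : exists w : chart A -> 'rV[R]_n,
    (forall b, dom b p -> w b = 'd (transition a b) (crd a p) v) /\
    (forall b, ~ dom b p -> w b = 0).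
  exists (fun b => if pselect (dom b p) is left _
    then 'd (transition a b) (crd a p) v else 0).
  by split=> b bp; case: pselect.
have wP : tangent_pred p w.
  apply/asboolP; split=> // b c bp cp; rewrite (wE b bp) (wE c cp).
  exact: esym (diff_transition_comp v ap bp cp).
by exists (exist _ w wP); rewrite -(diff_transition_id v ap); exact: wE.
Qed.

Lemma cpt0 p a : cpt (0 : tangent A p) a = 0. Proof. by []. Qed.

Lemma cptZ p (c : R) (v : tangent A p) a : cpt (c *: v) a = c *: cpt v a.
Proof. by []. Qed.

Lemma cpt_sum p (I : Type) (r : seq I) (P : pred I) (F : I -> tangent A p) a :
  cpt (\sum_(i <- r | P i) F i) a = \sum_(i <- r | P i) cpt (F i) a.
Proof. by elim/big_rec2: _ => // i u v _ <-. Qed.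

Definition jacobian_mx a b x : 'M[R]_n :=
  \matrix_(i, k) partial i (fun x => transition a b x 0 k) x.

Lemma diff_transitionE a b x v : local_dom idfun a b x ->
  'd (transition a b) x v = v *m jacobian_mx a b x.
Proof.
move=> abx; have dab := tame_diff tA abx; rewrite -deriveE//.
apply/rowP => k; rewrite derive_row// derive_partial.
  by rewrite mxE; apply: eq_bigr => i _; rewrite mxE.
exact: (differentiable_comp dab (differentiable_coord _ 0 k)).
Qed.

Lemma mul_jacobian a b p : dom a p -> dom b p ->
  jacobian_mx a b (crd a p) *m jacobian_mx b a (crd b p) = 1%:M.
Proof.
move=> ap bp; apply/row_matrixP => i; rewrite rowE mulmxA.
rewrite -diff_transitionE; last exact: crd_local_dom.
rewrite -diff_transitionE; last exact: crd_local_dom.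
by rewrite diff_transition_comp// diff_transition_id// -[LHS]mulmx1 -rowE.
Qed.

Lemma metric_transform (g : metric A) a b p : dom a p -> dom b p ->
  gmx g a (crd a p) = jacobian_mx a b (crd a p) *m gmx g b (crd b p)
                      *m (jacobian_mx a b (crd a p))^T.
Proof.
move=> ap bp; apply: bilinear_eq_mx => v w.
have [u uv] := exists_tangent v ap; have [u' uw] := exists_tangent w ap.
have := innerE g u u' bp; rewrite (innerE g u u' ap) uv uw => ->.
rewrite !(tangent_cpt _ ap bp) uv uw !(diff_transitionE _ (crd_local_dom ap bp)).
by rewrite trmx_mul !mulmxA.
Qed.

Lemma gmx_sym (g : metric A) a p : dom a p -> (gmx g a (crd a p))^T = gmx g a (crd a p).
Proof.
move=> ap; apply: bilinear_eq_mx => v w.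
have [u uv] := exists_tangent v ap; have [u' uw] := exists_tangent w ap.
have := inner_sym g u u'; rewrite !(innerE g _ _ ap) uv uw => ->.
have T (C : 'M[R]_1) : C 0 0 = C^T 0 0 by rewrite mxE.
by rewrite T !trmx_mul !trmxK mulmxA.
Qed.

Lemma gmx_pos (g : metric A) a p v : dom a p -> v != 0 ->
  0 < dot (gmx g a (crd a p)) v v.
Proof.
move=> ap v0; have [u uv] := exists_tangent v ap.
have u0 : u != 0 by apply: contraNneq v0 => u0; rewrite -uv u0.
by have := inner_pos g u0; rewrite (innerE g u u ap) uv.
Qed.

End TameAtlas.

Lemma diff_lsubmx (R : realType) m n1 n2 (z e : 'M[R]_(m, n1 + n2)) :
  'd lsubmx z e = lsubmx e.
Proof.
by rewrite diff_lin//; exact: continuous_lsubmx.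
Qed.

Section Manifold.
Context {R : realType} {n : nat} (M : manifold R n).
Implicit Types (a b : chart M).

Lemma open_chart_image a : open (crd a @` dom a).
Proof. by apply: crd_open => //; exact: dom_open. Qed.

Lemma Ck_transition k a b i :
  Ck k (local_dom idfun a b) (fun x => transition a b x 0 i).
Proof. by apply: smooth_Ck; exact: charts_smooth. Qed.

Lemma manifold_tame : tame_atlas M.
Proof.
split=> [a p q ap aq|a b|a b x abx].
- by move=> pq; apply: crd_inj pq; rewrite inE.
- apply: crd_open; first by move=> p [].
  by apply: openI; exact: dom_open.
- by apply: differentiable_row => i; have [+ _] := Ck_transition 1 a b i; exact.
Qed.

End Manifold.

(** * Charts of the tangent bundle and their transition maps *)

Section TangentBundleAtlas.
Context {R : realType} {X : Type} {n : nat} (A : atlas R X n) (tA : tame_atlas A).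
Context (smooth_transition : forall k (a b : chart A) i,
  Ck k (local_dom idfun a b) (fun x => transition a b x 0 i)).
Implicit Types (a b : chart A).

Lemma TM_crd_inj a (v w : TM A) : dom a (Defs.proj v) -> dom a (Defs.proj w) ->
  crd (a : chart (TM_atlas A)) v = crd (a : chart (TM_atlas A)) w -> v = w.
Proof.
case: v w => [p u] [q u'] /= ap aq /eq_row_mx[] /= /(tame_inj tA ap aq) pq.
by subst q => /(cpt_inj ap) /= ->.
Qed.

Lemma TM_crd_surj a x y : (crd a @` dom a) x ->
  exists v : TM A, dom a (Defs.proj v) /\ crd (a : chart (TM_atlas A)) v = row_mx x y.
Proof.
move=> [p ap <-]; have [u uy] := exists_tangent tA y ap.
by exists (existT _ p u); split => //=; rewrite uy.
Qed.

Lemma TM_local_dom a b : local_dom idfun (a : chart (TM_atlas A)) (b : chart (TM_atlas A))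
  = [set z | local_dom idfun a b (lsubmx z)].
Proof.
apply/seteqP; split=> [_ [v [/= av bv] <-]|z /= [p [ap bp] px]].
  by exists (Defs.proj v) => //=; rewrite row_mxKl.
have [u uy] := exists_tangent tA (rsubmx z) ap.
by exists (existT _ p u); [|rewrite /= uy px hsubmxK].
Qed.

Definition TM_trans a b (z : 'rV[R]_(n + n)) : 'rV[R]_(n + n) :=
  row_mx (transition a b (lsubmx z)) (rsubmx z *m jacobian_mx a b (lsubmx z)).

Lemma TM_transitionE a b z : local_dom idfun a b (lsubmx z) ->
  transition (a : chart (TM_atlas A)) (b : chart (TM_atlas A)) z = TM_trans a b z.
Proof.
move=> abz; have : local_dom idfun (a : chart (TM_atlas A)) (b : chart (TM_atlas A)) z.
  by rewrite TM_local_dom.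
move=> [v [av bv] <-].
apply: etrans (local_repE (A := TM_atlas A) (B := TM_atlas A) TM_crd_inj av bv) _.
have av' : dom a (Defs.proj v) := av; have bv' : dom b (Defs.proj v) := bv.
rewrite /TM_trans /= row_mxKl row_mxKr (transitionE tA av' bv') (tangent_cpt _ av' bv').
by rewrite (diff_transitionE tA)//; exact: crd_local_dom.
Qed.

Lemma differentiable_jacobian a b x i j : local_dom idfun a b x ->
  differentiable (fun x => jacobian_mx a b x i j) x.
Proof.
move=> abx; under eq_fun do rewrite mxE.
by have [_ /(_ i)[+ _]] := smooth_transition 2 a b j; exact.
Qed.

Lemma mder_TM_trans a b z e : local_dom idfun a b (lsubmx z) ->
  mder z e (TM_trans a b)
    (row_mx (lsubmx e *m jacobian_mx a b (lsubmx z))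
       (rsubmx e *m jacobian_mx a b (lsubmx z)
        + rsubmx z *m \sum_i lsubmx e 0 i *: partial_mx i (jacobian_mx a b) (lsubmx z))).
Proof.
move=> abz; apply: mder_row_mx; last first.
  apply: mderM; first exact: mder_rsubmx.
  by apply: mder_comp_lsubmx => i j; exact: differentiable_jacobian.
apply: mder_eq.
  apply: mder_comp_lsubmx => i j; rewrite (ord1 i).
  by have [+ _] := smooth_transition 1 a b j; exact.
rewrite [RHS]mulmx_sum_row; apply: eq_bigr => i _; congr (_ *: _).
by apply/rowP => j; rewrite !mxE.
Qed.

Lemma differentiable_TM_trans a b z : local_dom idfun a b (lsubmx z) ->
  differentiable (TM_trans a b) z.
Proof.
move=> abz; apply: differentiable_row => i.
by have [] := mder_TM_trans 0 abz 0 i.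
Qed.

Lemma near_TM_trans a b z : local_dom idfun a b (lsubmx z) ->
  {near z, TM_trans a b =1 transition (a : chart (TM_atlas A)) (b : chart (TM_atlas A))}.
Proof.
move=> abz; have oab := open_tube (@tame_open _ _ _ _ tA a b).
apply: filterS (open_nbhs_nbhs (conj oab abz)) => w abw.
by rewrite TM_transitionE.
Qed.

Lemma TM_tame : tame_atlas (TM_atlas A).
Proof.
split=> [a v w|a b|a b z].
- exact: TM_crd_inj.
- by rewrite TM_local_dom; exact: open_tube (@tame_open _ _ _ _ tA a b).
- rewrite TM_local_dom /= => abz.
  exact: near_eq_differentiable (near_TM_trans abz) (differentiable_TM_trans abz).
Qed.

(** The derivative of (x, y) -> (f(x), y J(x)), f being the transition map of the base; second
    derivatives of f appear in the fibre components. *)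
Lemma TM_tangent_cpt (v : TM A) (e : tangent (TM_atlas A) v) a b
    (x := crd a (Defs.proj v)) (J := jacobian_mx a b) (u := lsubmx (cpt e a)) :
  dom a (Defs.proj v) -> dom b (Defs.proj v) ->
  cpt e b = row_mx (u *m J x)
    (rsubmx (cpt e a) *m J x + cpt (vect v) a *m \sum_i u 0 i *: partial_mx i J x).
Proof.
move=> av bv; rewrite (tangent_cpt e av bv).
have abz : local_dom idfun a b (lsubmx (row_mx x (cpt (vect v) a))).
  by rewrite row_mxKl; exact: crd_local_dom.
have E := congr1 (fun h => h (cpt e a))
  (near_eq_diff (near_TM_trans abz) (differentiable_TM_trans abz)).
rewrite [LHS]E -deriveE; last exact: differentiable_TM_trans.
apply/rowP => k; rewrite derive_row; last exact: differentiable_TM_trans.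
by rewrite (fderE (mder_TM_trans (cpt e a) abz 0 k)) row_mxKl row_mxKr.
Qed.

Lemma diff_proj (v : TM A) a b (e : 'rV[R]_(n + n)) : dom a (Defs.proj v) -> dom b (Defs.proj v) ->
  'd (local_rep (@Defs.proj _ _ _ A) (a : chart (TM_atlas A)) b) (crd (a : chart (TM_atlas A)) v) e
  = 'd (transition a b) (crd a (Defs.proj v)) (lsubmx e).
Proof.
move=> av bv; set z := crd _ v.
have zx : lsubmx z = crd a (Defs.proj v) by rewrite /z /= row_mxKl.
have abz : local_dom idfun a b (lsubmx z) by rewrite zx; exact: crd_local_dom.
have oab := open_tube (@tame_open _ _ _ _ tA a b).
have E : {near z, transition a b \o lsubmx =1
    local_rep (@Defs.proj _ _ _ A) (a : chart (TM_atlas A)) b}.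
  apply: filterS (open_nbhs_nbhs (conj oab abz)) => w abw.
  have : local_dom idfun (a : chart (TM_atlas A)) (b : chart (TM_atlas A)) w.
    by rewrite TM_local_dom.
  move=> [v' [av' bv'] <-]; rewrite (local_repE (A := TM_atlas A) TM_crd_inj)//= row_mxKl.
  exact: transitionE.
have dl : differentiable (@lsubmx R 1 n n) z by exact: differentiable_lsubmx.
have dt := tame_diff tA abz.
have e1 := congr1 (fun h => h e) (near_eq_diff E (differentiable_comp dl dt)).
have e2 := congr1 (fun h => h e) (diff_comp dl dt).
rewrite -zx; apply: etrans (etrans e1 e2) _ => /=; congr ('d _ _ _).
exact: diff_lsubmx.
Qed.

(** Reduces a condition on all pairs of charts to one chart, by the chain rule for transition
    maps. *)
Lemma proj_starP (v : TM A) (e : tangent (TM_atlas A) v) (w : tangent A (Defs.proj v)) a :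
  dom a (Defs.proj v) -> proj_star e w <-> cpt w a = lsubmx (cpt e a).
Proof.
move=> av; split=> [/(_ a a av av)|wa b c bv cv].
  by rewrite diff_proj// (diff_transition_id tA).
rewrite diff_proj// (tangent_cpt w av cv) wa (TM_tangent_cpt e av bv) row_mxKl.
rewrite -diff_transitionE//; last exact: crd_local_dom.
exact: esym (diff_transition_comp tA _ av bv cv).
Qed.

End TangentBundleAtlas.

Section ConnectionTransformation.
Context {R : realType} {n : nat} (M : manifold R n) (g : metric M).
Implicit Types (a b : chart M).

Let tM := manifold_tame M.

Lemma Ck_gmx k a i j : Ck k (crd a @` dom a) (fun x => gmx g a x i j).
Proof. by apply: smooth_Ck; exact: gmx_smooth. Qed.

Lemma gmx_symU a x : (crd a @` dom a) x -> (gmx g a x)^T = gmx g a x.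
Proof. by move=> [p ap <-]; exact: gmx_sym tM _ _ _ ap. Qed.

Lemma gmx_posU a x v : (crd a @` dom a) x -> v != 0 -> 0 < dot (gmx g a x) v v.
Proof. by move=> [p ap <-]; exact: gmx_pos tM _ _ _ _ ap. Qed.

(* Both sides come from the unique torsion-free metric connection of
   [gmx g a], the right one by transport from the chart [b]. *)
Lemma connection_transform a b p i (x := crd a p) (J := jacobian_mx a b)
    (L := \sum_k J x i k *: connection (gmx g b) k (crd b p)) :
  dom a p -> dom b p ->
  connection (gmx g a) i x *m J x = partial_mx i J x + J x *m L.
Proof.
move=> ap bp; have abx : local_dom idfun a b x by exact: crd_local_dom.
have nW : \forall y \near x, local_dom idfun a b y by exact: near_local_dom tM _ _ _ ap bp.
have Ua : (crd a @` dom a) x by exists p.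
have Ub : (crd b @` dom b) (crd b p) by exists p.
have tx : transition a b x = crd b p by exact: (transitionE tM).
pose Ji := jacobian_mx b a (crd b p).
have JJi : J x *m Ji = 1%:M by exact: (mul_jacobian tM).
suff -> : connection (gmx g a) i x = (partial_mx i J x + J x *m L) *m Ji.
  by rewrite -mulmxA (mulmx1C JJi) mulmx1.
pose Lk l := \sum_k J x l k *: connection (gmx g b) k (crd b p).
have ug := metric_unitmx (@gmx_posU a) Ua.
have sg := metric_sym_near (@open_chart_image _ _ M a) (@gmx_symU a) Ua.
apply: (koszul (C := fun l => (partial_mx l J x + J x *m Lk l) *m Ji) ug sg).
- move=> l j k.
  have entryE (B : 'M[R]_n) c d : B c d = ((delta_mx 0 c : 'rV_n) *m B) 0 d.
    by rewrite -rowE mxE.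
  rewrite [LHS]entryE [RHS]entryE !mulmxA; congr ((_ *m _) _ _).
  rewrite !mulmxDr !mulmxA -!rowE.
  have -> : row j (partial_mx l J x) = row l (partial_mx j J x).
    apply/rowP => m; rewrite [LHS]mxE [RHS]mxE [LHS]mxE [RHS]mxE.
    have E c : (fun y => J y c m) = partial c (fun y => transition a b y 0 m).
      by apply/funext => y; rewrite mxE.
    rewrite !E; apply: partialC abx; last exact: Ck_transition.
    exact: (@tame_open _ _ _ _ tM a b).
  congr (_ + _).
  have E c d : row c (J x) *m Lk d = \sum_q \sum_k (J x c q * J x d k) *:
      row q (connection (gmx g b) k (crd b p)).
    rewrite mulmx_sum_row; apply: eq_bigr => q _; rewrite mxE linear_sum scaler_sumr.
    by apply: eq_bigr => k' _; rewrite linearZ scalerA.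
  rewrite !E exchange_big; apply: eq_bigr => q _; apply: eq_bigr => k' _.
  rewrite (connectionC (@open_chart_image _ _ M b) (@gmx_symU b) _ _ Ub) mulrC.
  by [].
- move=> l.
  have dJ : mder x (delta_mx 0 l) J (partial_mx l J x).
    apply: mder_partial => c d; apply: differentiable_jacobian abx.
    exact: Ck_transition.
  have dG : mder x (delta_mx 0 l) (fun y => gmx g b (transition a b y))
      (Lk l *m gmx g b (transition a b x) + gmx g b (transition a b x) *m (Lk l)^T).
    have h c d : fder x (delta_mx 0 l) (fun y => gmx g b (transition a b y) c d)
      (\sum_k J x l k * partial k (fun y => gmx g b y c d) (transition a b x)).
      apply: (fder_comp_row (f := fun y => gmx g b y c d) (h := transition a b)).
        move=> m; rewrite mxE; split=> //.
        by have [+ _] := Ck_transition 1 a b m; exact.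
      rewrite tx; have [+ _] := Ck_gmx 1 b c d; exact.
    move=> c d; apply: fder_eq (h c d) _; rewrite tx.
    have -> : Lk l *m gmx g b (crd b p) + gmx g b (crd b p) *m (Lk l)^T =
       \sum_k J x l k *: partial_mx k (gmx g b) (crd b p).
      rewrite /Lk mulmx_suml linear_sum mulmx_sumr -big_split; apply: eq_bigr => m _.
      rewrite (connectionP (@open_chart_image _ _ M b) (@gmx_symU b) (@gmx_posU b) _ Ub).
      by rewrite scalerDr linearZ/= -scalemxAl -scalemxAr.
    by rewrite summxE; apply: eq_bigr => m _; rewrite [RHS]mxE; congr (_ * _); rewrite mxE.
  have h := mder_congruence dJ dG (mulmx1C JJi).
  have E : {near x, (fun y => J y *m gmx g b (transition a b y) *m (J y)^T) =1 gmx g a}.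
    apply: filterS nW => _ [q [aq bq] <-].
    by rewrite (transitionE tM)// -(metric_transform tM).
  by rewrite (partial_mxE (near_eq_mder E h)) tx -(metric_transform tM g ap bp).
Qed.

Lemma covariant_derivativeE (G : 'rV[R]_n -> 'M[R]_n) x dx y dy :
  covariant_derivative G x dx y dy =
  dy + y *m \sum_i dx 0 i *: connection G i x.
Proof.
apply/rowP => k; rewrite [RHS]mxE [LHS]mxE; congr (_ + _).
rewrite [RHS]mxE exchange_big; apply: eq_bigr => j _.
rewrite summxE mulr_sumr; apply: eq_bigr => i _.
by rewrite [X in _ = _ * X]mxE mxE; ring.
Qed.

(** One chart decides: the second derivatives of the transition map in the fibre components of e
    cancel the inhomogeneous term in the transformation of the Christoffel symbols. *)
Lemma connection_mapP (v : TM M) (e : tangent (TM_atlas M) v)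
    (w : tangent M (Defs.proj v)) a : dom a (Defs.proj v) ->
  cpt w a = covariant_derivative (gmx g a) (crd a (Defs.proj v))
      (lsubmx (cpt e a)) (cpt (vect v) a) (rsubmx (cpt e a)) ->
  connection_map g e w.
Proof.
move=> av wa b bv; have abx := crd_local_dom av bv.
rewrite (TM_tangent_cpt tM (@Ck_transition _ _ M) e av bv) row_mxKl row_mxKr.
rewrite (tangent_cpt w av bv) (tangent_cpt (vect v) av bv) !(diff_transitionE tM)//.
rewrite wa !covariant_derivativeE mulmxDl -addrA; congr (_ + _).
rewrite -!mulmxA -mulmxDr; congr (_ *m _).
set u := lsubmx (cpt e a); set x := crd a _; set J := jacobian_mx a b.
rewrite mulmx_suml.
under eq_bigr do rewrite -scalemxAl (connection_transform _ av bv) -/x -/J scalerDr.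
rewrite big_split; congr (_ + _).
under eq_bigr do rewrite scalemxAr.
rewrite -mulmx_sumr; congr (_ *m _).
rewrite (eq_bigr (fun i => \sum_k (u 0 i * J x i k) *: connection (gmx g b) k (crd b (Defs.proj v)))); last first.
  by move=> i _; rewrite scaler_sumr; apply: eq_bigr => k _; rewrite scalerA.
by rewrite exchange_big; apply: eq_bigr => k _; rewrite mxE scaler_suml.
Qed.

End ConnectionTransformation.

(** * The coordinate expression of a natural metric *)

Lemma exists_orthonormal_mx2 (R : realType) (g : 'M[R]_2) : g^T = g ->
  (forall v : 'rV[R]_2, v != 0 -> 0 < dot g v v) ->
  exists O : 'M[R]_2, O *m g *m O^T = 1%:M.
Proof.
move=> gs gpos.
have e0 : (delta_mx 0 0 : 'rV[R]_2) != 0.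
  by apply/eqP => /rowP/(_ 0); rewrite !mxE/= => /eqP; rewrite oner_eq0.
(* The rows of O will be a coordinate vector and an orthogonal one, both normalised. *)
have [w w0 we] := exists_orthogonal gs gpos e0.
have norm v : v != 0 -> exists2 c, c ^+ 2 * dot g v v = 1 & True.
  move=> /gpos v0; exists (Num.sqrt (dot g v v))^-1 => //.
  by rewrite exprVn sqr_sqrtr ?ltW// mulVf// gt_eqF.
have [c1 h1 _] := norm _ e0; have [c2 h2 _] := norm _ w0.
pose r (i : 'I_2) : 'rV[R]_2 := if i == 0 then c1 *: delta_mx 0 0 else c2 *: w.
exists (\matrix_(i < 2) r i); apply/matrixP => i j.
have -> : (\matrix_(i < 2) r i *m g *m (\matrix_(i < 2) r i)^T) i j = dot g (r i) (r j).
  rewrite /dot -[in RHS](rowK r i) -[in RHS](rowK r j) -row_mul.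
  by rewrite [LHS]mxE [RHS]mxE; apply: eq_bigr => k _; rewrite !mxE.
have I2 (k : 'I_2) : k = 0 \/ k = 1.
  by case: k => -[|[|//]] ?; [left|right]; exact: val_inj.
have [->|->] := I2 i; have [->|->] := I2 j; rewrite /r/= mxE/= !(dotZl, dotZr).
- by rewrite mulrA -expr2 h1.
- by rewrite (dotC _ _ gs) we !mulr0.
- by rewrite we !mulr0.
- by rewrite mulrA -expr2 h2.
Qed.

Lemma congr_mx_inj (R : comUnitRingType) n (E X Y : 'M[R]_n) : E \in unitmx ->
  E *m X *m E^T = E *m Y *m E^T -> X = Y.
Proof.
move=> uE h; have uET : E^T \in unitmx by rewrite unitmx_tr.
by apply: (can_inj (mulKmx uE)); apply: (can_inj (mulmxK uET)).
Qed.

Lemma mul_hor_mx (R : realType) n (g : 'rV[R]_n -> 'M[R]_n) z (w : 'rV[R]_n) :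
  w *m hor_mx g z = rsubmx z *m \sum_i w 0 i *: connection g i (lsubmx z).
Proof.
rewrite mulmx_sum_row mulmx_sumr; apply: eq_bigr => i _.
by rewrite rowK scalemxAr.
Qed.

Lemma entry_rows (R : pzRingType) m n (A : 'M[R]_(m, n)) (B : 'M[R]_n) i j :
  (row i A *m B *m (row j A)^T) 0 0 = (A *m B *m A^T) i j.
Proof.
by rewrite -row_mul [LHS]mxE [RHS]mxE; apply: eq_bigr => k _; rewrite !mxE.
Qed.

Section NaturalMetricFormula.
Context {R : realType} {n : nat} (M : manifold R n) (g : metric M).
Context (G : metric (TM_atlas M)) (alpha beta : R -> R).
Context (chG : characterized g G alpha beta).

(* A point over [p] is written [vector_at u xi] for an orthonormal frame [u];
   the rows of [E] are then the components of the adapted basis. *)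
Lemma gmx_natural (a : chart M) x y (O : 'M[R]_n) : (crd a @` dom a) x ->
  O *m gmx g a x *m O^T = 1%:M ->
  gmx G (a : chart (TM_atlas M)) (row_mx x y)
  = nat_metric (gmx g a) alpha beta (row_mx x y).
Proof.
move=> [p ap xp] Oorth; subst x; set x := crd a p in Oorth *.
set ga := gmx g a in Oorth *; pose z := row_mx x y.
have tM := manifold_tame M.
have tTM := TM_tame tM (@Ck_transition _ _ M).
have OI : O *m (ga x *m O^T) = 1%:M by rewrite mulmxA.
(* The scalar products of y with the rows of O, hence its coordinates in that orthonormal basis. *)
pose xi := y *m (ga x *m O^T).
have xiO : xi *m O = y by rewrite /xi -mulmxA (mulmx1C OI) mulmx1.
have [u uE] : exists u : 'I_n -> tangent M p, forall i, cpt (u i) a = row i O.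
  exists (fun i => sval (cid (exists_tangent tM (row i O) ap))) => i; by case: cid.
have orth_u : Defs.orthonormal g u.
  move=> i j; rewrite (innerE g _ _ ap) !uE -/x -/ga.
  by rewrite entry_rows Oorth mxE.
pose v := vector_at u xi.
have av : dom a (Defs.proj v) by [].
have vy : cpt (vect v) a = y.
  rewrite /vect /= cpt_sum -xiO mulmx_sum_row; apply: eq_bigr => i _.
  by rewrite cptZ uE.
have vz : crd (a : chart (TM_atlas M)) v = z by rewrite /z -vy.
(* The upper rows are the horizontal lifts (u_i, - Gamma(u_i, y)), the lower rows the vertical lifts
   (0, u_i). *)
pose S := hor_mx ga z; pose E : 'M[R]_(n + n) := block_mx O (- (O *m S)) 0 O.
have [e eE] : exists e : 'I_(n + n) -> tangent (TM_atlas M) v,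
    forall I, cpt (e I) (a : chart (TM_atlas M)) = row I E.
  exists (fun I => sval (cid (exists_tangent tTM (row I E)
    (av : dom (a : chart (TM_atlas M)) v)))) => I; by case: cid.
have El i : row (lshift n i) E = row_mx (row i O) (- (row i O *m S)).
  rewrite /E /block_mx rowKu row_row_mx; congr (row_mx _ _).
  by rewrite linearN/= row_mul.
have Er i : row (rshift n i) E = row_mx 0 (row i O).
  by rewrite /E /block_mx rowKd row_row_mx row0.
have adap : adapted_basis g e.
  have hor i : row i O *m S = y *m \sum_k row i O 0 k *: connection ga k x.
    by rewrite /S mul_hor_mx /z row_mxKl row_mxKr.
  move=> i; split.
  - by apply/(proj_starP tM (@Ck_transition _ _ M) _ _ av); rewrite eE El row_mxKl uE.
  - apply: (connection_mapP (a := a)) => //.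
    rewrite eE El row_mxKl row_mxKr vy covariant_derivativeE cpt0.
    by rewrite hor addNr.
  - apply/(proj_starP tM (@Ck_transition _ _ M) _ _ av).
    by rewrite eE Er row_mxKl cpt0.
  - apply: (connection_mapP (a := a)) => //.
    rewrite eE Er row_mxKl row_mxKr covariant_derivativeE uE big1 ?mulmx0 ?addr0//.
    by move=> k _; rewrite mxE scale0r.
have innE I J : inner G (e I) (e J) = (E *m gmx G (a : chart (TM_atlas M)) z *m E^T) I J.
  by rewrite (innerE G _ _ (av : dom (a : chart (TM_atlas M)) v)) !eE vz entry_rows.
have [_ _ _ _ chE] := chG.
have EGE : E *m gmx G (a : chart (TM_atlas M)) z *m E^T =
    block_mx 1%:M 0 0 (alpha (sqnorm xi) *: 1%:M + beta (sqnorm xi) *: (xi^T *m xi)).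
  apply/matrixP => I J; rewrite -innE.
  case: (split_ordP I) => i ->; case: (split_ordP J) => j ->.
  - by have [-> _ _] := chE p u xi e orth_u adap i j; rewrite block_mxEul mxE.
  - by have [_ -> _] := chE p u xi e orth_u adap i j; rewrite block_mxEur mxE.
  - rewrite inner_sym; have [_ -> _] := chE p u xi e orth_u adap j i.
    by rewrite block_mxEdl mxE.
  - have [_ _ ->] := chE p u xi e orth_u adap i j.
    by rewrite block_mxEdr !mxE big_ord1 !mxE mulrA.
(* In the splitting (u, k) the adapted basis is two copies of the frame O. This shows that E is
   invertible and reduces the comparison of the two metrics to the blocks. *)
have EP : E *m adapt_mx ga z = block_mx O 0 0 O.
  rewrite /E /adapt_mx mulmx_block -/S !(mulmx0, mul0mx, mulmx1, addr0, add0r).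
  by rewrite addrC addNr.
have uE' : E \in unitmx.
  have [] // := @mulmx1_unit _ _ E (adapt_mx ga z *m block_mx (ga x *m O^T) 0 0 (ga x *m O^T)).
  rewrite mulmxA EP mulmx_block !(mulmx0, mul0mx, addr0, add0r) OI.
  by rewrite -scalar_mx_block.
apply: (congr_mx_inj uE'); rewrite -/z EGE /nat_metric.
set Gh := block_mx (ga _) _ _ _.
have -> : E *m (adapt_mx ga z *m Gh *m (adapt_mx ga z)^T) *m E^T =
    (E *m adapt_mx ga z) *m Gh *m (E *m adapt_mx ga z)^T.
  by rewrite trmx_mul !mulmxA.
rewrite EP /Gh tr_block_mx !trmx0 !mulmx_block !(mulmx0, mul0mx, addr0, add0r).
have zx : lsubmx z = x by rewrite /z row_mxKl.
have zy : rsubmx z = y by rewrite /z row_mxKr.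
have Oy : O *m ga x *m y^T = xi^T.
  by rewrite -xiO trmx_mul mulmxA Oorth mul1mx.
have yO : y *m ga x *m O^T = xi by rewrite /xi mulmxA.
have sq : sqlen ga z = sqnorm xi.
  rewrite /sqlen /dot zx zy -{2}xiO trmx_mul mulmxA yO mxE.
  by apply: eq_bigr => k _; rewrite [X in _ * X = _]mxE -expr2.
rewrite zx Oorth /fibre_metric sq zx zy mulmxDr mulmxDl -!scalemxAr -!scalemxAl.
by rewrite Oorth !mulmxA Oy -(mulmxA xi^T) -(mulmxA xi^T) yO.
Qed.

End NaturalMetricFormula.

Lemma eq0_on_basis (R : pzRingType) n (W : lmodType R) (F : 'rV[R]_n -> W) :
  linear F -> (forall i, F (delta_mx 0 i) = 0) -> forall v, F v = 0.
Proof.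
move=> lF F0 v; have F00 : F 0 = 0.
  by apply: (addrI (F 0)); rewrite addr0 -{1}[F 0]scale1r -lF scaler0 addr0.
rewrite (row_sum_delta v); elim/big_rec: _ => // i w _ Fw.
by rewrite lF F0 Fw scaler0 addr0.
Qed.

Section FibreCurvatureTensor.
Context {R : realType} {n : nat} (g : 'M[R]_n) (gs : g^T = g).
Context (y : 'rV[R]_n) (a b d a1 b1 d1 : R).
Local Notation K := (fibre_curvature g y a b d a1 b1 d1).

Lemma fibre_curvature_anti k l v : K k l v = - K l k v.
Proof. by rewrite !(fibre_curvatureE gs); apply/rowP => j; rewrite !mxE; ring. Qed.

Lemma fibre_curvature_linear l v : linear (fun k => K k l v).
Proof.
move=> c k k'; rewrite !(fibre_curvatureE gs) !(dotDl, dotZl).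
by apply/rowP => j; rewrite !mxE; ring.
Qed.

(** Coordinate fields of the fibre supply only basis vectors as k and l; bilinearity, obtained from
    linearity in k and skew-symmetry, gives the rest. *)
Lemma fibre_curvature_basis : (forall i j v, K (delta_mx 0 i) (delta_mx 0 j) v = 0) ->
  forall k l v, K k l v = 0.
Proof.
move=> K0 k l v; apply: (eq0_on_basis (F := fun k => K k l v)) => [|i].
  exact: fibre_curvature_linear.
rewrite fibre_curvature_anti; apply/eqP; rewrite oppr_eq0; apply/eqP.
apply: (eq0_on_basis (F := fun l => K l (delta_mx 0 i) v)) => [|j].
  exact: fibre_curvature_linear.
exact: K0.
Qed.

End FibreCurvatureTensor.

Lemma kappa_rshift (R : realType) n (g : 'rV[R]_n -> 'M[R]_n) z (i : 'I_n) :
  kappa g (rshift n i) z = delta_mx 0 i.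
Proof.
rewrite /kappa /fibre_part rsubmx_delta_rshift /conn_along big1 ?mulmx0 ?addr0// => j _.
by rewrite /base_part lsubmx_delta_rshift mxE scale0r.
Qed.

Lemma curvature_mx_eq0 (R : realType) n (g : 'rV[R]_n -> 'M[R]_n) x :
  (forall i j, curvature_mx g i j x = 0) <->
  (forall i j k l, curvature g i j k l x = 0).
Proof.
split=> [K0 i j k l|K0 i j].
  by have /matrixP/(_ k l) := K0 i j; rewrite curvature_mxE !mxE.
by apply/matrixP => k l; rewrite curvature_mxE !mxE K0.
Qed.

(** * Flatness of the tangent bundle in terms of the curvature of the fibres *)

Section Main.
Context {R : realType} (M : manifold R 2%N) (g : metric M).
Context (G : metric (TM_atlas M)) (alpha beta : R -> R).
Context (chG : characterized g G alpha beta).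

Let tM := manifold_tame M.
Let tTM := TM_tame tM (@Ck_transition _ _ M).
Let alpha1 := half_deriv alpha.
Let beta1 := half_deriv beta.
Let alpha2 := half_deriv alpha1.
Let beta2 := half_deriv beta1.

Let da t : 0 <= t -> hder alpha t (alpha1 t).
Proof. by case: chG => + _ _ _ _; exact: (half_smooth_hder 0). Qed.
Let da1 t : 0 <= t -> hder alpha1 t (alpha2 t).
Proof. by case: chG => + _ _ _ _; exact: (half_smooth_hder 1). Qed.
Let db t : 0 <= t -> hder beta t (beta1 t).
Proof. by case: chG => _ + _ _ _; exact: (half_smooth_hder 0). Qed.
Let db1 t : 0 <= t -> hder beta1 t (beta2 t).
Proof. by case: chG => _ + _ _ _; exact: (half_smooth_hder 1). Qed.
Let a_gt0 t : 0 <= t -> 0 < alpha t. Proof. by case: chG => _ _ + _ _; exact. Qed.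
Let D_gt0 t : 0 <= t -> 0 < alpha t + t * beta t.
Proof. by case: chG => _ _ _ + _; exact. Qed.

Lemma TM_chart_image (a : chart M) z :
  (crd (a : chart (TM_atlas M)) @` dom (a : chart (TM_atlas M))) z <->
  tube (crd a @` dom a) z.
Proof.
split=> [[v av <-]|Uz]; first by exists (Defs.proj v) => //=; rewrite row_mxKl.
have [v [av vz]] := TM_crd_surj tM (rsubmx z) Uz.
by exists v => //; rewrite vz hsubmxK.
Qed.

Lemma gmx_TM (a : chart M) z : tube (crd a @` dom a) z ->
  gmx G (a : chart (TM_atlas M)) z = nat_metric (gmx g a) alpha beta z.
Proof.
move=> Uz; rewrite -[z]hsubmxK.
have [B BgB] := exists_orthonormal_mx2 (gmx_symU g Uz) (fun w => @gmx_posU _ _ M g a _ w Uz).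
have Ux : (crd a @` dom a) (lsubmx z) := Uz.
exact: (gmx_natural chG (rsubmx z) Ux BgB).
Qed.

Lemma gmx_TM_pos (a : chart M) z v : tube (crd a @` dom a) z -> v != 0 ->
  0 < dot (gmx G (a : chart (TM_atlas M)) z) v v.
Proof. by move=> /TM_chart_image[w aw <-]; exact: (gmx_pos tTM). Qed.

Lemma H_fun_coef t : 0 <= t ->
  H_fun alpha beta t = coef_H (alpha t) (alpha1 t) (alpha2 t) (beta t) (beta1 t) t.
Proof. by case: chG => ? ? ? ? _ t0; rewrite H_funE. Qed.

Lemma flat_base : flat G -> flat g.
Proof.
move=> flG a x Ux; apply/curvature_mx_eq0 => i j.
apply: (flat_base_of_flat (@open_chart_image _ _ M a) (fun k => Ck_gmx g k a)
  (@gmx_symU _ _ M g a) (@gmx_posU _ _ M g a) da db a_gt0 D_gt0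
  (@gmx_TM a) (@gmx_TM_pos a) Ux) => e f.
apply/curvature_mx_eq0: e f; apply: flG; apply/TM_chart_image.
by rewrite /tube/= row_mxKl.
Qed.

(** Applies [nat_curvature_eq0] in every natural chart, whose image is the whole tube over the image
    of the chart of M. *)
Lemma flat_TM_fcurv : flat g -> flat G <-> forall (a : chart M) z e f v,
  tube (crd a @` dom a) z ->
  fcurv (gmx g a) alpha beta alpha1 beta1 alpha2 z
    (kappa (gmx g a) e z) (kappa (gmx g a) f z) v = 0.
Proof.
move=> flg; have curvP (a : chart M) z (Uz : tube (crd a @` dom a) z) :=
  nat_curvature_eq0 (@open_chart_image _ _ M a) (fun k => Ck_gmx g k a)
  (@gmx_symU _ _ M g a) (@gmx_posU _ _ M g a) da db da1 db1 a_gt0 D_gt0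
  (fun x i j Ux => (curvature_mx_eq0 _ _).2 (flg a x Ux) i j)
  (@gmx_TM a) (@gmx_TM_pos a) Uz.
split=> [flG a z e f v Uz|K0 a z /TM_chart_image Uz].
  apply: (curvP a z Uz).1 => {}e {}f; apply/curvature_mx_eq0: e f.
  by apply: flG; apply/TM_chart_image.
by apply/curvature_mx_eq0; apply: (curvP a z Uz).2 => e f v; exact: K0.
Qed.

End Main.

Theorem corollary4p3 (R : realType) (M : manifold R 2%N) (g : metric M)
    (G : metric (TM_atlas M)) (alpha beta : R -> R) :
  natural_metric g G -> characterized g G alpha beta ->
  flat G <-> flat g /\ (forall t : R, 0 <= t -> H_fun alpha beta t = 0).
Proof.
move=> _ chG; have [_ _ a_gt0 D_gt0 _] := chG.
split=> [flG|[flg H0]]; last first.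
  apply/(flat_TM_fcurv chG flg) => a z e f v Uz.
  have t0 := sqlen_ge0 (@gmx_posU _ _ M g a) Uz.
  apply: fibre_curvature_eq0; [exact: gmx_symU Uz|by move=> w; exact: gmx_posU Uz|
    exact: a_gt0|exact: D_gt0|by []|].
  by rewrite -(H_fun_coef chG) ?H0.
have flg := flat_base chG flG; split=> // t t0.
have [p _] := space_nonempty M; have [a ap] := charts_cover p.
have Ux : (crd a @` dom a) (crd a p) by exists p.
set ga := gmx g a (crd a p).
have gs : ga^T = ga by exact: gmx_symU Ux.
have gpos (v : 'rV_2) : v != 0 -> 0 < dot ga v v by exact: gmx_posU Ux.
have e0 : (delta_mx 0 0 : 'rV[R]_2) != 0.
  by apply/eqP => /rowP/(_ 0); rewrite !mxE/= => /eqP; rewrite oner_eq0.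
(* A coordinate vector rescaled to have y.y = t; it lies in the chart because the tube contains
   whole fibres. *)
pose y : 'rV[R]_2 := Num.sqrt (t / dot ga (delta_mx 0 0) (delta_mx 0 0)) *: delta_mx 0 0.
have yt : dot ga y y = t.
  rewrite /y dotZl dotZr mulrA -expr2 sqr_sqrtr ?divfK ?gt_eqF ?gpos//.
  by rewrite divr_ge0// ltW// gpos.
have Uz : tube (crd a @` dom a) (row_mx (crd a p) y) by rewrite /tube/= row_mxKl.
rewrite (H_fun_coef chG)//.
have K0 := (flat_TM_fcurv chG flg).1 flG a _ _ _ _ Uz.
apply: (coef_H_eq0 gs gpos (a_gt0 _ t0) (D_gt0 _ t0) yt).
apply: fibre_curvature_basis => // i j v.
(* The fibre coordinate fields are vertical, with the basis vectors as images under the connection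
   map. *)
have := K0 (rshift 2 i) (rshift 2 j) v.
rewrite !kappa_rshift /fcurv /sqlen row_mxKl row_mxKr -/ga yt; exact.
Qed.
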